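(* For each of the two topologies $\tau^-$ and $\tau^+$, the space $\mathrm{Gr}^{\pm}(n)=(\mathrm{Gr}(n),\tau^\pm)$ is compact, contractible, path connected and simply connected; and $(\mathrm{Gr}(n),d)$ is Smyth bicomplete, where $d$ is any one of the nine asymmetric metrics $d_{\mathrm{g}},d_{\mathrm{cF}},d_{\mathrm{pF}},d_{\mathrm{FS}},d_{\mathrm{c\wedge}},d_{\mathrm{BC}},d_{\mathrm{A}},d_{\mathrm{c2}},d_{\mathrm{p2}}$.
   Context: $\mathbb{F}=\mathbb{R}$ or $\mathbb{C}$, $\mathbb{F}^n$ has its canonical inner product (Hermitian if $\mathbb{F}=\mathbb{C}$), and $\mathrm{Gr}(n)$ is the set of all subspaces of $\mathbb{F}^n$; $V_{(p)}$ indicates $\dim V=p$. Principal angles of $V_{(p)},W_{(q)}$ with $m=\min\{p,q\}\neq0$: $0\leq\theta_1\leq\cdots\leq\theta_m\leq\frac\pi2$, $\theta_i=\cos^{-1}\sigma_i$, where $\sigma_1\geq\cdots\geq\sigma_m$ are the singular values of the orthogonal projection $V\to W$. Asymmetric metrics: for $V_{(p)},W_{(q)}$, $d(V,W)=0$ if $p=0$, and $d(V,W)=\Delta_{p,d}$ if $p>q$. If $0<p\leq q$: $d_{\mathrm{g}}=\sqrt{\sum_{i=1}^p\theta_i^2}$, $d_{\mathrm{cF}}=2\sqrt{\sum_{i=1}^p\sin^2\frac{\theta_i}{2}}$, $d_{\mathrm{pF}}=\sqrt{\sum_{i=1}^p\sin^2\theta_i}$, $d_{\mathrm{FS}}=\cos^{-1}(\prod_{i=1}^p\cos\theta_i)$,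 $d_{\mathrm{c\wedge}}=\sqrt{2-2\prod_{i=1}^p\cos\theta_i}$, $d_{\mathrm{BC}}=\sqrt{1-\prod_{i=1}^p\cos^2\theta_i}$, $d_{\mathrm{A}}=\theta_p$, $d_{\mathrm{c2}}=2\sin\frac{\theta_p}{2}$, $d_{\mathrm{p2}}=\sin\theta_p$. For $p>0$ the constants $\Delta_{p,d}$ are, respectively, $\frac\pi2\sqrt p$, $\sqrt{2p}$, $\sqrt p$, $\frac\pi2$, $\sqrt2$, $1$, $\frac\pi2$, $\sqrt2$, $1$. Topologies: $\tau^-$ is generated by the balls $B_r^-(V)=\{U:d(U,V)<r\}$ and $\tau^+$ by $B_r^+(V)=\{U:d(V,U)<r\}$ (they are the same for all nine $d$). Let $\hat d(x,y)=\max\{d(x,y),d(y,x)\}$. A sequence $x_k$ is left (respectively right) K-Cauchy if given $\epsilon>0$ there is $N\in\mathbb{N}$ such that $d(x_k,x_l)<\epsilon$ (respectively $d(x_l,x_k)<\epsilon$) whenever $N\leq k\leq l$. If any left (respectively right) K-Cauchy sequence has $\hat d(x_k,x)\to0$ for some point $x$ of the space, the space is left (respectively right) Smyth complete. It is Smyth bicomplete if it is both. *)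

(* Defs.v *)
From HB Require Import structures.
From mathcomp Require Import all_boot all_order all_algebra.
From mathcomp Require Import sesquilinear complex.
From mathcomp Require Import all_classical all_reals all_analysis.
From mathcomp Require Import homotopy.

Set Implicit Arguments.
Unset Strict Implicit.
Unset Printing Implicit Defensive.

Import Order.TTheory GRing.Theory Num.Theory.
Import numFieldNormedType.Exports.

Local Open Scope classical_set_scope.
Local Open Scope ring_scope.

Variant scalar_kind := RealScalars | ComplexScalars.

Definition scalars (R : realType) (k : scalar_kind) : numFieldType :=
  match k with RealScalars => R : numFieldType | ComplexScalars => R[i] end.

Definition of_real (R : realType) (k : scalar_kind) : R -> scalars R k :=
  match k return R -> scalars R k with
  | RealScalars => id
  | ComplexScalars => real_complex R
  end.

Definition conj_scalar (R : realType) (k : scalar_kind) :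
    involutive_rmorphism (scalars R k) :=
  match k return involutive_rmorphism (scalars R k) with
  | RealScalars => @idfun (R : numFieldType)
  | ComplexScalars => @Num.conj R[i]
  end.

Notation Gr R k n := {vspace 'rV[scalars R k]_n}.

Section InnerProduct.
Variables (R : realType) (k : scalar_kind) (n : nat).
Local Notation F := (scalars R k).
Local Notation dot_def :=
  (form_of_matrix (conj_scalar R k) (1%:M : 'M[F]_n)).

Definition dot (u v : 'rV[F]_n) : F := dot_def u v.

Lemma dotE u v : dot u v = \sum_(i < n) u 0 i * conj_scalar R k (v 0 i).
Proof.
rewrite /dot /form_of_matrix mulmx1 trace_mx11 mxE.
by apply: eq_bigr => i _; rewrite !mxE.
Qed.

Fact dot_hermitian u v :
  dot u v = (-1) ^+ false * conj_scalar R k (dot v u).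
Proof.
rewrite expr0 mul1r !dotE rmorph_sum; apply: eq_bigr => i _ /=.
rewrite rmorphM mulrC; congr (_ * _); exact/esym/rmorphK.
Qed.

HB.instance Definition _ := Bilinear.copy dot dot_def.
HB.instance Definition _ :=
  isHermitianSesquilinear.Build _ _ false (conj_scalar R k) dot dot_hermitian.

Definition orthonormal_basis (V : Gr R k n) (e : seq 'rV[F]_n) : bool :=
  basis_of V e && orthonormal dot e.

Definition orthoproj (W : Gr R k n) : 'End('rV[F]_n) :=
  daddv_pi W (orthov dot W).

(* s lists the singular values of the restriction T : V -> W, with
   multiplicity and in decreasing order: it is the diagonal of a singular
   value decomposition of T in orthonormal bases of V and W. *)
Definition is_singular_values (V W : Gr R k n) (T : 'End('rV[F]_n))
    (s : seq R) : Prop :=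
  let m := minn (\dim V) (\dim W) in
  [/\ size s = m,
      sorted >=%R s,
      {in s, forall x, 0 <= x} &
      exists e f : seq 'rV[F]_n,
        [/\ orthonormal_basis V e,
            orthonormal_basis W f,
            forall i, (i < m)%N -> T e`_i = of_real k s`_i *: f`_i &
            forall i, (m <= i < \dim V)%N -> T e`_i = 0]].

Definition singular_values (V W : Gr R k n) (T : 'End('rV[F]_n)) : seq R :=
  xget [::] [set s | is_singular_values V W T s].

(* 0-based: theta_(i+1) is the entry of index i. *)
Definition principal_angles (V W : Gr R k n) : seq R :=
  [seq acos x | x <- singular_values V W (orthoproj W)].

End InnerProduct.

Variant metric_name :=
  | Geodesic             (* g *)
  | ChordalFrobenius     (* cF *)
  | ProjectionFrobenius  (* pF *)
  | FubiniStudy          (* FS *)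
  | ChordalWedge         (* c-wedge *)
  | BinetCauchy          (* BC *)
  | Asimov               (* A *)
  | Chordal2             (* c2 *)
  | Projection2.         (* p2 *)

Section AsymmetricMetrics.
Variable R : realType.

Definition angle_metric (d : metric_name) (p : nat) (theta : seq R) : R :=
  match d with
  | Geodesic => Num.sqrt (\sum_(i < p) theta`_i ^+ 2)
  | ChordalFrobenius => 2 * Num.sqrt (\sum_(i < p) sin (theta`_i / 2) ^+ 2)
  | ProjectionFrobenius => Num.sqrt (\sum_(i < p) sin theta`_i ^+ 2)
  | FubiniStudy => acos (\prod_(i < p) cos theta`_i)
  | ChordalWedge => Num.sqrt (2 - 2 * \prod_(i < p) cos theta`_i)
  | BinetCauchy => Num.sqrt (1 - \prod_(i < p) cos theta`_i ^+ 2)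
  | Asimov => theta`_p.-1
  | Chordal2 => 2 * sin (theta`_p.-1 / 2)
  | Projection2 => sin theta`_p.-1
  end.

Definition Delta (d : metric_name) (p : nat) : R :=
  match d with
  | Geodesic => pi / 2 * Num.sqrt p%:R
  | ChordalFrobenius => Num.sqrt (2 * p%:R)
  | ProjectionFrobenius => Num.sqrt p%:R
  | FubiniStudy => pi / 2
  | ChordalWedge => Num.sqrt 2
  | BinetCauchy => 1
  | Asimov => pi / 2
  | Chordal2 => Num.sqrt 2
  | Projection2 => 1
  end.

Definition asym_dist (k : scalar_kind) (n : nat) (d : metric_name)
    (V W : Gr R k n) : R :=
  if \dim V == 0%N then 0
  else if (\dim W < \dim V)%N then Delta d (\dim V)
  else angle_metric d (\dim V) (principal_angles V W).

End AsymmetricMetrics.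

Arguments asym_dist {R k n} d V W.

Variant side := Minus | Plus.

Section BallTopology.
Variables (R : realType) (T : choiceType).

Definition asym_ball (s : side) (d : T -> T -> R) (x : T) (r : R) : set T :=
  match s with
  | Minus => [set y | d y x < r]
  | Plus => [set y | d x y < r]
  end.

(* The carrier T with the topology generated by the balls of the given side. *)
Definition ball_space (s : side) (d : T -> T -> R) : Type := T.

Variables (s : side) (d : T -> T -> R).

Definition ball_subbase : set (set T) :=
  [set B | exists x r, 0 < r /\ B = asym_ball s d x r].

HB.instance Definition _ := Choice.on (ball_space s d).
HB.instance Definition _ :=
  isSubBaseTopological.Build (ball_space s d) ball_subbase id.

End BallTopology.

Definition unit_interval (R : realType) : Type := `[0 : R, 1]%classic.

Section UnitInterval.
Variable R : realType.

HB.instance Definition _ := Topological.on (unit_interval R).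

Fact unit_interval0 : (0 : R) \in `[0 : R, 1]%classic.
Proof. by apply/mem_set; rewrite /= in_itv /= lexx ler01. Qed.

Fact unit_interval1 : (1 : R) \in `[0 : R, 1]%classic.
Proof. by apply/mem_set; rewrite /= in_itv /= lexx ler01. Qed.

Let i0 : unit_interval R := SigSub unit_interval0.
Let i1 : unit_interval R := SigSub unit_interval1.

Fact unit_interval_neq : i0 != i1.
Proof. by apply/eqP => /(congr1 set_val) /= /eqP; rewrite eq_sym oner_eq0. Qed.

HB.instance Definition _ :=
  isBiPointed.Build (unit_interval R) unit_interval_neq.

End UnitInterval.

Section Homotopy.
Variables (R : realType) (T : topologicalType).
Local Notation I := (unit_interval R).

Definition path_connected : Prop :=
  forall x y : T, inhabited {path I from x to y in T}.

Definition contractible : Prop :=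
  exists (c : T) (H : T * I -> T),
    [/\ continuous H, forall x, H (x, zero) = x & forall x, H (x, one) = c].

Definition null_homotopic (x : T) (g : {path I from x to x in T}) : Prop :=
  exists H : I * I -> T,
    [/\ continuous H,
        forall s, H (s, zero) = g s,
        forall s, H (s, one) = x &
        forall t, H (zero, t) = x /\ H (one, t) = x].

Definition simply_connected : Prop :=
  path_connected /\
  forall (x : T) (g : {path I from x to x in T}), null_homotopic g.

End Homotopy.

Section Smyth.
Variables (R : realType) (T : Type) (d : T -> T -> R).

Definition left_K_Cauchy (x : nat -> T) : Prop :=
  forall eps : R, 0 < eps ->
    exists N, forall k l, (N <= k)%N -> (k <= l)%N -> d (x k) (x l) < eps.

Definition right_K_Cauchy (x : nat -> T) : Prop :=
  forall eps : R, 0 < eps ->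
    exists N, forall k l, (N <= k)%N -> (k <= l)%N -> d (x l) (x k) < eps.

Definition sym_dist (x y : T) : R := Num.max (d x y) (d y x).

Definition left_Smyth_complete : Prop :=
  forall x : nat -> T, left_K_Cauchy x ->
    exists a : T, (fun k => sym_dist (x k) a) @ \oo --> (0 : R).

Definition right_Smyth_complete : Prop :=
  forall x : nat -> T, right_K_Cauchy x ->
    exists a : T, (fun k => sym_dist (x k) a) @ \oo --> (0 : R).

Definition Smyth_bicomplete : Prop :=
  left_Smyth_complete /\ right_Smyth_complete.

End Smyth.

(* Main.v *)
Require Import Defs.
From HB Require Import structures.
From mathcomp Require Import all_boot all_order all_algebra.
From mathcomp Require Import ring lra.
From mathcomp Require Import sesquilinear spectral complex.
From mathcomp Require Import all_classical all_reals all_analysis.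
From mathcomp Require Import homotopy.

Set Implicit Arguments.
Unset Strict Implicit.
Unset Printing Implicit Defensive.

Import Order.TTheory GRing.Theory Num.Theory.
Import numFieldNormedType.Exports.

Local Open Scope classical_set_scope.
Local Open Scope ring_scope.

(** The statement has a soft topological half and a metric half.

    Topology. Since d(V, W) never exceeds the constant Delta of dim V, which
    grows with dim V, a ball of radius r of the tau^- topology that contains
    the whole space F^n has r larger than every distance or is centred at F^n,
    and is then all of Gr(n).  So the only tau^- neighbourhood of F^n is Gr(n);
    for tau^+ the zero subspace has the same property.  A point c with a single
    neighbourhood (a _blunt_ point below) is a limit of every filter, hence
    compactness; and a map into the space that sends a point p to c is
    continuous at p whatever it does elsewhere.  One may therefore glue maps
    along closed sets that are sent to c: the contraction jumps to c at time 1,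
    a path from x to y passes through c at time 1/2, and a loop bounds the
    disc on which it is extended radially, the centre going to c.

    Smyth completeness.  A value d(V, W) < 1 forces dim V <= dim W, so the
    dimensions along a K-Cauchy sequence are eventually monotone, hence
    eventually a constant p.  For subspaces of equal dimension all nine metrics
    are equivalent to the gap, the largest distance from a unit vector of one
    to the other: if theta_p is the largest principal angle then
    sin theta_p <= d(V, W) <= p theta_p (angle_metric_ge_sin and
    angle_metric_le, the latter while p theta_p <= pi / 2), and sin theta_p is
    the gap.  Passing from the metric to the gap requires the singular value
    decomposition to exist (exists_singular_values), which comes from the
    spectral theorem for the compression to V of the projection onto W;
    exchanging the two orthonormal bases of the decomposition makes the gap
    symmetric.  A gap-Cauchy sequence has Cauchy orthogonal projections; their
    pointwise limit is idempotent, and its fixed space is the limit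
    (gap_cauchy_limit). *)

(** * Bounds for the nine functions of the principal angles *)

Section Angles.
Variable R : realType.
Implicit Types (x y phi : R) (theta : seq R).

Lemma sin_le_id x : 0 <= x -> sin x <= x.
Proof.
move=> x0.
have [c _ E] : exists2 c, c \in `[0, x] & sin x - sin 0 = cos c * (x - 0).
  apply: (@MVT_segment R (@sin R) (@cos R)) => //.
  by apply: continuous_subspaceT => z; exact: continuous_sin.
move: E; rewrite sin0 !subr0 => ->.
by rewrite ler_piMl // cos_le1.
Qed.

Lemma sin_ge0_pihalf x : 0 <= x <= pi / 2 -> 0 <= sin x.
Proof.
move=> /andP[x0 x1]; apply: sin_ge0_pi; rewrite x0 /=.
by have := pi_ge0 R; lra.
Qed.

Lemma cos_ge0_quadrant x : 0 <= x <= pi / 2 -> 0 <= cos x.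
Proof.
move=> /andP[x0 x1]; apply: cos_ge0_pihalf; rewrite x1 andbT.
by have := pi_ge0 R; lra.
Qed.

Lemma cos_nonincreasing x y : 0 <= x -> x <= y -> y <= pi -> cos y <= cos x.
Proof.
move=> x0 xy y1; have p0 := pi_ge0 R.
by rewrite leNgt ltr_cos -?leNgt // in_itv /=; apply/andP; split; lra.
Qed.

Lemma acos_le x phi :
  x <= 1 -> 0 <= phi <= pi -> cos phi <= x -> acos x <= phi.
Proof.
move=> x1 /andP[p0 p1] h; have p2 := pi_ge0 R.
have xN : -1 <= x by apply: le_trans h; exact: cos_geN1.
have xI : -1 <= x <= 1 by rewrite xN.
rewrite leNgt -ltr_cos ?in_itv /= ?p0 ?acos_ge0 ?acos_lepi //.
by rewrite acosK ?in_itv //= -leNgt.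
Qed.

Lemma acos_ge x phi :
  x <= 1 -> 0 <= phi <= pi -> -1 <= x -> x <= cos phi -> phi <= acos x.
Proof.
move=> x1 /andP[p0 p1] xN h; have p2 := pi_ge0 R.
have xI : -1 <= x <= 1 by rewrite xN.
rewrite leNgt -ltr_cos ?in_itv /= ?p0 ?acos_ge0 ?acos_lepi //.
by rewrite acosK ?in_itv //= -leNgt.
Qed.

Lemma one_sub_cos x : 1 - cos x = 2 * sin (x / 2) ^+ 2.
Proof.
have {1}-> : x = (x / 2) *+ 2 by rewrite -mulr_natr; lra.
by rewrite cos_mulr2n cos2sin2; ring.
Qed.

Lemma sin_half x : sin x = 2 * sin (x / 2) * cos (x / 2).
Proof.
have {1}-> : x = (x / 2) *+ 2 by rewrite -mulr_natr; lra.
by rewrite sin_mulr2n -mulr_natr; ring.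
Qed.

(** This is what compares the three metrics built on the product of the cosines
    (the Fubini-Study, chordal wedge and Binet-Cauchy ones) with the sum of the
    angles: for two angles in the first quadrant the addition formula gives
    cos a cos b = cos (a + b) + sin a sin b. *)
Lemma prod_cos_ge p theta : (forall i, (i < p)%N -> 0 <= theta`_i) ->
  \sum_(i < p) theta`_i <= pi / 2 ->
  cos (\sum_(i < p) theta`_i) <= \prod_(i < p) cos theta`_i.
Proof.
elim: p => [|p IH] t0 ts; first by rewrite !big_ord0 cos0.
have s0 : 0 <= \sum_(i < p) theta`_i.
  by apply: sumr_ge0 => i _; apply: t0; rewrite ltnS ltnW.
have tp := t0 p (ltnSn p); have p0 := pi_ge0 R.
move: ts; rewrite !big_ord_recr /= => ts.
have ts' : \sum_(i < p) theta`_i <= pi / 2 by lra.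
have {}IH := IH (fun i ip => t0 i (ltnW ip : (i < p.+1)%N)) ts'.
rewrite cosD.
apply: (@le_trans _ _ (cos (\sum_(i < p) theta`_i) * cos theta`_p)).
  rewrite gerBl mulr_ge0 // sin_ge0_pihalf //; apply/andP; split; lra.
by rewrite ler_wpM2r // cos_ge0_quadrant //; apply/andP; split; lra.
Qed.

Lemma prod_cos_itv p theta :
  (forall i, (i < p)%N -> 0 <= theta`_i <= pi / 2) ->
  0 <= \prod_(i < p) cos theta`_i <= 1.
Proof.
move=> h; rewrite prodr_ge0 /=; last first.
  by move=> i _; apply: cos_ge0_quadrant; exact: h.
apply: prodr_ile1 => i _; rewrite cos_le1 andbT.
by apply: cos_ge0_quadrant; exact: h.
Qed.

Lemma prod_cos_le_last p theta : (0 < p)%N ->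
  (forall i, (i < p)%N -> 0 <= theta`_i <= pi / 2) ->
  \prod_(i < p) cos theta`_i <= cos theta`_p.-1.
Proof.
case: p => // p _ h; rewrite big_ord_recr /= ler_piMl //.
  exact/cos_ge0_quadrant/h.
have hp i : (i < p)%N -> 0 <= theta`_i <= pi / 2 by move=> /ltnW/h.
by have /andP[] := prod_cos_itv hp.
Qed.

(** The largest angle alone contributes at least its sine: in the l2 type
    metrics as one term of the sum, in the others because the product of the
    cosines is at most the last one. *)
Lemma angle_metric_ge_sin d p theta : (0 < p)%N ->
  (forall i, (i < p)%N -> 0 <= theta`_i <= pi / 2) ->
  sin theta`_p.-1 <= angle_metric d p theta.
Proof.
move=> p0 h; have pp : (p.-1 < p)%N by rewrite prednK.
have hp := h _ pp; have /andP[t0 t1] := hp; have pi0 := pi_ge0 R.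
have s0 := sin_ge0_pihalf hp; have c0 := cos_ge0_quadrant hp.
have /andP[P0 P1] := prod_cos_itv h.
have Pl := prod_cos_le_last p0 h.
have h2 : 0 <= theta`_p.-1 / 2 <= pi / 2 by apply/andP; split; lra.
have s20 := sin_ge0_pihalf h2; have c20 := cos_ge0_quadrant h2.
have s2 : sin theta`_p.-1 <= 2 * sin (theta`_p.-1 / 2).
  by rewrite sin_half ler_piMr ?mulr_ge0 ?cos_le1.
have sumsq (f : R -> R) : f theta`_p.-1 ^+ 2 <= \sum_(i < p) f theta`_i ^+ 2.
  rewrite (bigD1 (Ordinal pp)) //= lerDl sumr_ge0 // => i _; exact: sqr_ge0.
have sqrt_ge (f : R -> R) : 0 <= f theta`_p.-1 ->
    f theta`_p.-1 <= Num.sqrt (\sum_(i < p) f theta`_i ^+ 2).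
  by move=> f0; rewrite -[leLHS]ger0_norm // -sqrtr_sqr ler_wsqrtr.
case: d => /=.
- by apply: le_trans (sqrt_ge id t0); exact: sin_le_id.
- by apply: (le_trans s2); rewrite ler_pM2l // (sqrt_ge (fun x => sin (x / 2))).
- exact: (sqrt_ge sin).
- apply: (le_trans (sin_le_id t0)); apply: acos_ge => //; lra.
- apply: (le_trans s2).
  rewrite -[leLHS]ger0_norm ?mulr_ge0 // -sqrtr_sqr ler_wsqrtr //.
  by have := one_sub_cos theta`_p.-1; nra.
- rewrite -[leLHS]ger0_norm // -sqrtr_sqr ler_wsqrtr // sin2cos2 lerD2l lerN2.
  by rewrite prodrXl ler_sqr ?nnegrE.
- exact: sin_le_id.
- exact: s2.
- exact: lexx.
Qed.

(** With A the arc cosine of the product of the cosines, the chordal wedge and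
    Binet-Cauchy metrics are 2 sin (A / 2) and sin A, both at most A, which
    [prod_cos_ge] bounds by the sum of the angles. *)
Lemma angle_metric_le d p theta phi : (0 < p)%N -> p%:R * phi <= pi / 2 ->
  (forall i, (i < p)%N -> 0 <= theta`_i <= phi) ->
  angle_metric d p theta <= p%:R * phi.
Proof.
move=> p0 pphi h; have pp : (p.-1 < p)%N by rewrite prednK.
have /andP[t0 t1] := h _ pp; have pi0 := pi_ge0 R.
have p1 : 1 <= p%:R :> R by rewrite ler1n.
have phi0 : 0 <= phi by exact: le_trans t1.
have phip : phi <= p%:R * phi by rewrite ler_peMl.
have hq i : (i < p)%N -> 0 <= theta`_i <= pi / 2.
  by move=> /h/andP[-> /= hi]; lra.
have /andP[P0 P1] := prod_cos_itv hq.
have sumphi : \sum_(i < p) theta`_i <= p%:R * phi.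
  apply: (@le_trans _ _ (\sum_(i < p) phi)).
    by apply: ler_sum => i _; have /andP[] := h i (ltn_ord i).
  by rewrite sumr_const card_ord mulr_natl.
have s0 : 0 <= \sum_(i < p) theta`_i.
  by apply: sumr_ge0 => i _; have /andP[] := h i (ltn_ord i).
have Pge : cos (p%:R * phi) <= \prod_(i < p) cos theta`_i.
  apply: le_trans (prod_cos_ge _ _); last lra.
    by apply: cos_nonincreasing => //; lra.
  by move=> i /h /andP[].
have FS : acos (\prod_(i < p) cos theta`_i) <= p%:R * phi.
  by apply: acos_le => //; apply/andP; split; lra.
have PI : \prod_(i < p) cos theta`_i \in `[-1, 1].
  by rewrite in_itv /=; apply/andP; split; lra.
have a0 : 0 <= acos (\prod_(i < p) cos theta`_i).
  by apply: acos_ge0; apply/andP; split; lra.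
have a2 : 0 <= acos (\prod_(i < p) cos theta`_i) / 2 by rewrite divr_ge0.
have l2 (f : R -> R) : (forall x, 0 <= x -> x <= phi -> 0 <= f x <= phi) ->
    Num.sqrt (\sum_(i < p) f theta`_i ^+ 2) <= p%:R * phi.
  move=> hf; rewrite -[leRHS]ger0_norm ?mulr_ge0 // -sqrtr_sqr ler_wsqrtr //.
  apply: (@le_trans _ _ (\sum_(i < p) phi ^+ 2)).
    apply: ler_sum => i _; have /andP[ti0 ti1] := h i (ltn_ord i).
    have /andP[f0 f1] := hf _ ti0 ti1; by rewrite ler_sqr ?nnegrE.
  rewrite sumr_const card_ord -mulr_natl; nra.
have q2 : pi / 2 <= pi :> R by lra.
case: d => /=.
- by apply: (l2 id) => x -> ->.
- apply: le_trans (l2 (fun x => 2 * sin (x / 2)) _) => [|x x0 x1].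
    under [in leRHS]eq_bigr do rewrite exprMn.
    by rewrite -mulr_sumr sqrtrM ?sqr_ge0 // sqrtr_sqr ger0_norm.
  have : sin (x / 2) <= x / 2 by apply: sin_le_id; lra.
  have : 0 <= sin (x / 2) by apply: sin_ge0_pihalf; apply/andP; split; lra.
  by move=> *; apply/andP; split; lra.
- apply: (l2 sin) => x x0 x1; rewrite (le_trans (sin_le_id x0)) // andbT.
  by apply: sin_ge0_pihalf; apply/andP; split; lra.
- exact: FS.
- set a := acos _ in FS a0 a2.
  have -> : 2 - 2 * \prod_(i < p) cos theta`_i = (2 * sin (a / 2)) ^+ 2.
    by have := one_sub_cos a; rewrite acosK // exprMn; lra.
  rewrite sqrtr_sqr ger0_norm ?mulr_ge0 //.
    by have := sin_le_id a2; lra.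
  by apply: sin_ge0_pihalf; rewrite a2 /=; lra.
- rewrite prodrXl -(acosK PI) -sin2cos2 sqrtr_sqr ger0_norm.
    exact: le_trans (sin_le_id a0) FS.
  by apply: sin_ge0_pihalf; rewrite a0 (le_trans FS).
- lra.
- have : sin (theta`_p.-1 / 2) <= theta`_p.-1 / 2 by apply: sin_le_id; lra.
  lra.
- have := sin_le_id t0; lra.
Qed.

Lemma angle_metric_le_Delta d p theta : (0 < p)%N ->
  (forall i, (i < p)%N -> 0 <= theta`_i <= pi / 2) ->
  angle_metric d p theta <= Delta R d p.
Proof.
move=> p0 h; have pp : (p.-1 < p)%N by rewrite prednK.
have hp := h _ pp; have /andP[t0 t1] := hp; have pi0 := pi_ge0 R.
have /andP[P0 P1] := prod_cos_itv h.
have l2 (f : R -> R) c : (forall x, 0 <= x <= pi / 2 -> f x ^+ 2 <= c) ->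
    Num.sqrt (\sum_(i < p) f theta`_i ^+ 2) <= Num.sqrt (c * p%:R).
  move=> hf; rewrite ler_wsqrtr // (@le_trans _ _ (\sum_(i < p) c)) //.
    by apply: ler_sum => i _; apply/hf/h.
  by rewrite sumr_const card_ord mulr_natr.
have half2 x : 0 <= x <= pi / 2 -> sin (x / 2) ^+ 2 <= 2^-1.
  by move=> /cos_ge0_quadrant c0; have := one_sub_cos x; lra.
case: d => /=.
- apply: le_trans (l2 id ((pi / 2) ^+ 2) _) _ => [x /andP[x0 x1]|].
    by rewrite ler_sqr ?nnegrE //=; lra.
  by rewrite sqrtrM ?sqr_ge0 // sqrtr_sqr ger0_norm //; lra.
- have -> : 2 * p%:R = 2 ^+ 2 * (2^-1 * p%:R) :> R by field.
  rewrite [leRHS]sqrtrM ?sqr_ge0 // sqrtr_sqr ger0_norm // ler_pM2l //.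
  exact: (l2 (fun x => sin (x / 2))).
- rewrite -[in leRHS](mul1r p%:R); apply: l2 => x _.
  by rewrite sin2cos2 gerBl sqr_ge0.
- apply: acos_le => //; rewrite ?cos_pihalf //.
  by apply/andP; split; lra.
- by rewrite ler_wsqrtr //; lra.
- by rewrite -[leRHS]sqrtr1 ler_wsqrtr // prodrXl gerBl sqr_ge0.
- exact: t1.
- have s0 : 0 <= sin (theta`_p.-1 / 2).
    by apply: sin_ge0_pihalf; apply/andP; split; lra.
  rewrite -[leLHS]ger0_norm ?mulr_ge0 // -sqrtr_sqr ler_wsqrtr //.
  have := half2 _ hp; rewrite exprMn; lra.
- exact: sin_le1.
Qed.

Lemma Delta_ge1 d p : (0 < p)%N -> 1 <= Delta R d p.
Proof.
move=> p0; have q := pihalf_ge1 R.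
have p1 : 1 <= p%:R :> R by rewrite ler1n.
have s1 x : 1 <= x -> 1 <= Num.sqrt x :> R.
  by move=> ?; rewrite -sqrtr1 ler_wsqrtr.
case: d => //=; try (by apply: s1; lra).
by rewrite -[leLHS]mulr1 ler_pM // s1.
Qed.

Lemma Delta_nondecreasing d p q : (p <= q)%N -> Delta R d p <= Delta R d q.
Proof.
move=> pq; have pi0 := pi_ge0 R.
have pqR : p%:R <= q%:R :> R by rewrite ler_nat.
case: d => //=; do ?by rewrite ler_wsqrtr // ler_pM2l.
by rewrite ler_wpM2l ?ler_wsqrtr //; lra.
Qed.
End Angles.

(** * Spaces with a blunt point *)

Section UnitIntervalMaps.
Variable R : realType.
Local Notation I := (unit_interval R).

Definition uval : I -> R := @set_val _ _.

Lemma uval_continuous : continuous uval.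
Proof. exact: (@initial_continuous `[0 : R, 1]%classic R set_val). Qed.

Lemma uval0 : uval zero = 0. Proof. by []. Qed.
Lemma uval1 : uval one = 1. Proof. by []. Qed.

Lemma uval_itv (t : I) : 0 <= uval t <= 1.
Proof. by have /set_mem := valP t; rewrite /= in_itv. Qed.

Lemma uval_inj : injective uval.
Proof. by move=> s t st; apply: val_inj. Qed.

Lemma clamp_subproof (x : R) : Num.max 0 (Num.min 1 x) \in `[0 : R, 1]%classic.
Proof.
apply/mem_set; rewrite /= in_itv /= le_max lexx /= ge_max ler01 /=.
by rewrite ge_min lexx.
Qed.

Definition clamp (x : R) : I := SigSub (clamp_subproof x).

Lemma uval_clamp x : uval (clamp x) = Num.max 0 (Num.min 1 x).
Proof. by []. Qed.

Lemma uvalK (t : I) : clamp (uval t) = t.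
Proof.
apply: uval_inj; rewrite uval_clamp; have /andP[t0 t1] := uval_itv t.
by rewrite min_r // max_r.
Qed.

Lemma clamp_le0 x : x <= 0 -> clamp x = zero.
Proof.
move=> x0; apply: uval_inj; rewrite uval_clamp uval0 max_l //.
by rewrite ge_min x0 orbT.
Qed.

Lemma clamp_ge1 x : 1 <= x -> clamp x = one.
Proof.
by move=> x1; apply: uval_inj; rewrite uval_clamp uval1 min_l // max_r.
Qed.

Lemma clamp_continuous : continuous clamp.
Proof.
apply: (@continuous_comp_initial `[0 : R, 1]%classic R R set_val).
move=> x; apply: (@continuous_max R R (cst 0) (fun x => Num.min 1 x)).
  exact: cst_continuous.
apply: (@continuous_min R R (cst 1) id) => //; exact: cst_continuous.
Qed.

End UnitIntervalMaps.

Section BluntPoint.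
Variables (R : realType) (T : topologicalType) (c : T).
Local Notation I := (unit_interval R).

Hypothesis blunt : forall U, nbhs c U -> U = setT.

(** The only continuity condition at a point sent to c is about the whole
    space, so the behaviour of h near p is free. *)
Lemma continuous_at_blunt (X : topologicalType) (h : X -> T) p :
  h p = c -> {for p, continuous h}.
Proof. by move=> hp U; rewrite /= hp => /blunt ->; exact: filterT. Qed.

Lemma continuous_at_near (X Y : topologicalType) (h g : X -> Y) p :
  (\forall q \near p, h q = g q) ->
  {for p, continuous g} -> {for p, continuous h}.
Proof.
move=> hg cg; rewrite /prop_for /continuous_at (nbhs_singleton hg).
by apply: cvg_trans cg; apply: near_eq_cvg; near=> q; apply/esym; near: q.
Unshelve. all: by end_near. Qed.

Lemma near_lt (X : topologicalType) (f : X -> R) p a :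
  {for p, continuous f} -> f p < a -> \forall q \near p, f q < a.
Proof. by move=> cf; exact: (@cvgr_lt R X (nbhs p) _ f (f p) cf). Qed.

Lemma near_gt (X : topologicalType) (f : X -> R) p a :
  {for p, continuous f} -> a < f p -> \forall q \near p, a < f q.
Proof. by move=> cf; exact: (@cvgr_gt R X (nbhs p) _ f (f p) cf). Qed.

Lemma uval_fst_continuous (X : topologicalType) :
  continuous (fun q : I * X => uval q.1).
Proof.
move=> [s t]; have h : fst @ (s, t) --> s by exact: cvg_fst.
exact: (cvg_comp _ _ h (@uval_continuous R s)).
Qed.

Lemma uval_snd_continuous (X : topologicalType) :
  continuous (fun q : X * I => uval q.2).
Proof.
move=> [s t]; have h : snd @ (s, t) --> t by exact: cvg_snd.
exact: (cvg_comp _ _ h (@uval_continuous R t)).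
Qed.

Lemma half_lt1 : 2^-1 < 1 :> R.
Proof. by rewrite invf_lt1 // ltr1n. Qed.

Lemma blunt_compact : compact [set: T].
Proof.
move=> F FF _; exists c; split => // A B FA /blunt ->; rewrite setIT.
exact: filter_ex FA.
Qed.

Lemma blunt_contractible : contractible R T.
Proof.
exists c, (fun q => if q.2 == one then c else q.1); split => [[x t]|x|x] /=.
- have [->|t1] := eqVneq t one.
    by apply: continuous_at_blunt; rewrite /= eqxx.
  have ut : uval t < 1.
    have /andP[_] := uval_itv t; rewrite le_eqVlt => /predU1P[|//].
    by rewrite -uval1 => /uval_inj /eqP; rewrite (negbTE t1).
  apply: (@continuous_at_near _ _ _ fst); last exact: cvg_fst.
  have := near_lt (@uval_snd_continuous T (x, t)) ut.
  by apply: filterS => q; case: eqVneq => // ->; rewrite uval1 ltxx.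
- by rewrite (negbTE zero_one_neq).
- by rewrite eqxx.
Qed.

Lemma blunt_path_connected : path_connected R T.
Proof.
move=> x y.
pose f (t : I) := if uval t < 2^-1 then x else if uval t == 2^-1 then c else y.
have cf : continuous f.
  move=> t; have [th|th|th] := ltgtP (uval t) 2^-1.
  - apply: (@continuous_at_near _ _ _ (cst x)); last exact: cst_continuous.
    have := near_lt (@uval_continuous R t) th.
    by apply: filterS => u; rewrite /f => ->.
  - apply: (@continuous_at_near _ _ _ (cst y)); last exact: cst_continuous.
    have := near_gt (@uval_continuous R t) th.
    by apply: filterS => u; rewrite /f; case: ltgtP.
  - by apply: continuous_at_blunt; rewrite /f th ltxx eqxx.
have f0 : f zero = x by rewrite /f uval0 invr_gt0 ltr0n.
have f1 : f one = y.
  by rewrite /f uval1 gt_eqF ?half_lt1 // ltNge ltW ?half_lt1.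
exact: (inhabits (mk_path cf f0 f1 : {path I from x to y in T})).
Qed.

(** The loop g on the bottom side of the unit square and the constant x on the
    other sides extend to the square by radial projection from its centre, which
    itself is sent to c.  The ray from the centre through (s, t), t < 1/2, meets
    the line t = 0 at abscissa r(s, t); clamping that abscissa to [0, 1] gives x
    as soon as the ray leaves through another side, and for t >= 1/2 every ray
    does so. *)
Lemma blunt_simply_connected : simply_connected R T.
Proof.
split=> [|x g]; first exact: blunt_path_connected.
pose r (q : I * I) := 2^-1 + (uval q.1 - 2^-1) / (1 - 2 * uval q.2).
pose H q := if uval q.2 < 2^-1 then g (clamp (r q)) else
  if (uval q.1 == 2^-1) && (uval q.2 == 2^-1) then c else x.
have c1 : continuous (fun q : I * I => uval q.1) := @uval_fst_continuous I.
have c2 : continuous (fun q : I * I => uval q.2) := @uval_snd_continuous I.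
(* H is x where s <= t and where s + t >= 1, off the line s = 1/2; these two
   regions are neighbourhoods of the left and right halves of the line
   t = 1/2. *)
have HL q : uval q.1 <= uval q.2 -> uval q.1 != 2^-1 -> H q = x.
  rewrite /H => st s2; rewrite (negbTE s2) /=; case: ltP => // th.
  rewrite clamp_le0 ?path_zero //.
  have d0 : 0 < 1 - 2 * uval q.2 by lra.
  by rewrite /r -lerBrDl ler_pdivrMr //; lra.
have HR q : 1 <= uval q.1 + uval q.2 -> uval q.1 != 2^-1 -> H q = x.
  rewrite /H => st s2; rewrite (negbTE s2) /=; case: ltP => // th.
  rewrite clamp_ge1 ?path_one //.
  have d0 : 0 < 1 - 2 * uval q.2 by lra.
  by rewrite /r -lerBlDl ler_pdivlMr //; lra.
exists H; split.
- move=> q; have [th|th|th] := ltgtP (uval q.2) 2^-1.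
  + apply: (@continuous_at_near _ _ _ (fun q => g (clamp (r q)))).
      have := near_lt (c2 q) th.
      by apply: filterS => u; rewrite /H => ->.
    have cr : {for q, continuous r}.
      apply: cvgD; first exact: cvg_cst.
      apply: cvgM; first by apply: cvgB; [exact: c1|exact: cvg_cst].
      apply: cvgV; first by apply/eqP; lra.
      by apply: cvgB; [exact: cvg_cst|apply: cvgM; [exact: cvg_cst|exact: c2]].
    apply: (@continuous_comp _ _ _ r (g \o @clamp R)) => //.
    by apply: continuous_comp; [exact: clamp_continuous|exact: cts_fun].
  + apply: (@continuous_at_near _ _ _ (cst x)); last exact: cst_continuous.
    have := near_gt (c2 q) th.
    by apply: filterS => u; rewrite /H; case: ltgtP => //; rewrite andbF.
  + have [sh|sh|sh] := ltgtP (uval q.1) 2^-1.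
    * apply: (@continuous_at_near _ _ _ (cst x)); last exact: cst_continuous.
      have : \forall u \near q, uval u.1 - uval u.2 < 0.
        apply: (near_lt (f := fun u : I * I => uval u.1 - uval u.2)).
          by apply: cvgB; [exact: c1|exact: c2].
        by rewrite subr_lt0 th.
      have := near_lt (c1 q) sh.
      by apply: filterS2 => u u1 u2; apply: HL; lra.
    * apply: (@continuous_at_near _ _ _ (cst x)); last exact: cst_continuous.
      have : \forall u \near q, 1 < uval u.1 + uval u.2.
        apply: (near_gt (f := fun u : I * I => uval u.1 + uval u.2)).
          by apply: cvgD; [exact: c1|exact: c2].
        by rewrite th; move: (uval q.1) sh => a ha; lra.
      have := near_gt (c1 q) sh.
      by apply: filterS2 => u u1 u2; apply: HR; lra.
    * by apply: continuous_at_blunt; rewrite /H th sh ltxx eqxx.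
- move=> s; rewrite /H /r uval0 invr_gt0 ltr0n /= mulr0 subr0 divr1 addrC subrK.
  by rewrite uvalK.
- move=> s; rewrite /H /= uval1 [1 == _]gt_eqF ?half_lt1 //.
  by rewrite ltNge ltW ?half_lt1 //= andbF.
- move=> t; have /andP[t0 t1] := uval_itv t.
  split; [apply: HL|apply: HR]; rewrite /= ?uval0 ?uval1 ?lerDl //.
    by rewrite lt_eqF // invr_gt0.
  by rewrite gt_eqF // half_lt1.
Qed.

End BluntPoint.

(** * The Hermitian inner product of F^n *)

Section Scalars.
Variables (R : realType) (k : scalar_kind).
Local Notation F := (scalars R k).
Local Notation conj := (conj_scalar R k).
Implicit Types (x y : R) (z : F).

Definition re : F -> R :=
  match k return scalars R k -> R with
  | RealScalars => id
  | ComplexScalars => @complex.Re R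
  end.

Definition im : F -> R :=
  match k return scalars R k -> R with
  | RealScalars => fun=> 0
  | ComplexScalars => @complex.Im R
  end.

Fact of_real_is_zmod_morphism : zmod_morphism (@of_real R k).
Proof. by case: k => //= x y; exact: rmorphB. Qed.

Fact of_real_is_monoid_morphism : monoid_morphism (@of_real R k).
Proof. by case: k => //=; split; [exact: rmorph1|exact: rmorphM]. Qed.

HB.instance Definition _ :=
  GRing.isZmodMorphism.Build R F (@of_real R k) of_real_is_zmod_morphism.
HB.instance Definition _ :=
  GRing.isMonoidMorphism.Build R F (@of_real R k) of_real_is_monoid_morphism.

Fact re_is_zmod_morphism : zmod_morphism re.
Proof. by rewrite /re; case: k => //= -[a b] [c d]. Qed.
HB.instance Definition _ :=
  GRing.isZmodMorphism.Build F R re re_is_zmod_morphism.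

Lemma of_realK x : re (of_real k x) = x.
Proof. by rewrite /re; case: k. Qed.

Lemma conj_of_real x : conj (of_real k x) = of_real k x.
Proof. by case: k => //=; apply/eqP; rewrite eq_complex /= oppr0 !eqxx. Qed.

Lemma re_conj z : re (conj z) = re z.
Proof. by move: z; rewrite /re; case: k => //= -[a b]. Qed.

Lemma re_of_realM x z : re (of_real k x * z) = x * re z.
Proof.
by move: z; rewrite /re; case: k => //= -[a b] /=; rewrite mul0r subr0.
Qed.

Lemma mul_conj z : z * conj z = of_real k (re z ^+ 2 + im z ^+ 2).
Proof.
move: z; rewrite /re /im; case: k => /= [z|[a b]].
  by rewrite expr0n addr0 -expr2.
by apply/eqP; rewrite eq_complex /=; apply/andP; split; apply/eqP; ring.
Qed.

Lemma conj_eq_real z : conj z = z -> z = of_real k (re z).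
Proof.
move: z; rewrite /re; case: k => //= -[a b] [] hb; congr (_ +i* _)%C.
by move: hb; lra.
Qed.

Definition sqabs z : R := re z ^+ 2 + im z ^+ 2.

Lemma sqabs_ge0 z : 0 <= sqabs z.
Proof. by rewrite addr_ge0 ?sqr_ge0. Qed.

Lemma sqabs_eq0 z : (sqabs z == 0) = (z == 0).
Proof.
rewrite paddr_eq0 ?sqr_ge0 // !sqrf_eq0; move: z; rewrite /re /im.
case: k => /= [z|[a b]]; first by rewrite eqxx andbT.
by rewrite eq_complex.
Qed.

End Scalars.

(* Norm estimates only use the real inner product [inner], the real part of
   [dot], so that they can be carried out in R for both kinds of scalars. *)
Section RealInner.
Variables (R : realType) (k : scalar_kind) (n : nat).
Local Notation F := (scalars R k).
Local Notation conj := (conj_scalar R k).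
Local Notation dot := (@dot R k n).
Implicit Types (u v w : 'rV[F]_n) (V W : Gr R k n).

Lemma dotC u v : dot u v = conj (dot v u).
Proof. by rewrite dot_hermitian expr0 mul1r. Qed.

Lemma dotDl u v w : dot (u + v) w = dot u w + dot v w.
Proof. exact: linearDl. Qed.
Lemma dotDr u v w : dot w (u + v) = dot w u + dot w v.
Proof. exact: linearDr. Qed.
Lemma dotBl u v w : dot (u - v) w = dot u w - dot v w.
Proof. exact: linearBl. Qed.
Lemma dotBr u v w : dot w (u - v) = dot w u - dot w v.
Proof. exact: linearBr. Qed.
Lemma dotZl a u v : dot (a *: u) v = a * dot u v.
Proof.
by rewrite !dotE mulr_sumr; apply: eq_bigr => i _; rewrite mxE mulrA.
Qed.
Lemma dotZr a u v : dot u (a *: v) = conj a * dot u v.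
Proof. by rewrite dotC dotZl rmorphM /= -dotC. Qed.
Lemma dot0l u : dot 0 u = 0.
Proof. exact: linear0l. Qed.
Lemma dot0r u : dot u 0 = 0.
Proof. exact: linear0r. Qed.
Lemma dot_suml I (r : seq I) (P : pred I) (f : I -> 'rV[F]_n) v :
  dot (\sum_(i <- r | P i) f i) v = \sum_(i <- r | P i) dot (f i) v.
Proof. exact: linear_sumlz. Qed.
Lemma dot_sumr I (r : seq I) (P : pred I) (f : I -> 'rV[F]_n) v :
  dot v (\sum_(i <- r | P i) f i) = \sum_(i <- r | P i) dot v (f i).
Proof. exact: linear_sumr. Qed.

Lemma dot_eq0C u v : dot u v = 0 -> dot v u = 0.
Proof. by move=> uv; rewrite dotC uv rmorph0. Qed.

Definition sqnorm u : R := re (dot u u).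

Lemma sqnormE u : sqnorm u = \sum_i sqabs (u 0 i).
Proof.
rewrite /sqnorm dotE raddf_sum /=; apply: eq_bigr => i _.
by rewrite mul_conj of_realK.
Qed.

Lemma sqnorm_ge0 u : 0 <= sqnorm u.
Proof. by rewrite sqnormE sumr_ge0 // => i _; exact: sqabs_ge0. Qed.

Lemma sqnorm_eq0 u : (sqnorm u == 0) = (u == 0).
Proof.
apply/eqP/eqP => [u0|->]; last by rewrite /sqnorm dot0l raddf0.
apply/rowP => i; rewrite mxE; apply/eqP.
rewrite -sqabs_eq0 eq_le sqabs_ge0 andbT.
move: u0; rewrite sqnormE (bigD1 i) //= => <-.
by rewrite lerDl sumr_ge0 // => j _; exact: sqabs_ge0.
Qed.

Lemma dot_sqnorm u : dot u u = of_real k (sqnorm u).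
Proof. by rewrite /sqnorm; apply: conj_eq_real; rewrite -dotC. Qed.

Definition inner u v : R := re (dot u v).

Lemma innerC u v : inner u v = inner v u.
Proof. by rewrite /inner dotC re_conj. Qed.

Lemma sqnormD u v : sqnorm (u + v) = sqnorm u + 2 * inner u v + sqnorm v.
Proof.
rewrite /sqnorm dotDl !dotDr !raddfD /= -/(inner u v) -/(inner v u).
by rewrite (innerC v u) /sqnorm; ring.
Qed.

Lemma sqnormZ a u : sqnorm (a *: u) = sqabs a * sqnorm u.
Proof.
by rewrite /sqnorm dotZl dotZr mulrA mul_conj re_of_realM.
Qed.

Lemma sqnorm_realZ x u : sqnorm (of_real k x *: u) = x ^+ 2 * sqnorm u.
Proof.
by rewrite /sqnorm dotZl dotZr conj_of_real !re_of_realM mulrA expr2.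
Qed.

Lemma sqnormN u : sqnorm (- u) = sqnorm u.
Proof. by rewrite /sqnorm linearNl linearNr opprK. Qed.

Lemma sqnorm_orthoD u v : dot u v = 0 -> sqnorm (u + v) = sqnorm u + sqnorm v.
Proof. by rewrite sqnormD /inner => ->; rewrite raddf0 mulr0 addr0. Qed.

(** Cauchy-Schwarz: expand the norm of u - (inner u v / |v|^2) v. *)
Lemma inner_le u v : inner u v <= Num.sqrt (sqnorm u) * Num.sqrt (sqnorm v).
Proof.
have [->|v0] := eqVneq v 0.
  by rewrite /inner dot0r raddf0 mulr_ge0 ?sqrtr_ge0.
have pv : 0 < sqnorm v by rewrite lt_def sqnorm_eq0 v0 sqnorm_ge0.
apply: le_trans (ler_norm _) _; rewrite -sqrtrM ?sqnorm_ge0 // -sqrtr_sqr.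
rewrite ler_wsqrtr //.
have := sqnorm_ge0 (u + of_real k (- (inner u v / sqnorm v)) *: v).
rewrite sqnormD sqnorm_realZ /inner dotZr conj_of_real re_of_realM.
rewrite -/(inner u v).
set a := inner u v; set b := sqnorm v in pv *; rewrite sqrrN.
have -> : sqnorm u + 2 * (- (a / b) * a) + (a / b) ^+ 2 * b =
    sqnorm u - a ^+ 2 / b.
  by field; rewrite gt_eqF.
by rewrite subr_ge0 ler_pdivrMr.
Qed.

Definition nrm u := Num.sqrt (sqnorm u).

Lemma nrm_ge0 u : 0 <= nrm u. Proof. exact: sqrtr_ge0. Qed.

Lemma nrm_sqr u : nrm u ^+ 2 = sqnorm u.
Proof. by rewrite sqr_sqrtr ?sqnorm_ge0. Qed.

Lemma nrm_eq0 u : (nrm u == 0) = (u == 0).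
Proof. by rewrite -sqnorm_eq0 -nrm_sqr sqrf_eq0. Qed.

Lemma nrmN u : nrm (- u) = nrm u.
Proof. by rewrite /nrm sqnormN. Qed.

Lemma nrmBC u v : nrm (u - v) = nrm (v - u).
Proof. by rewrite -nrmN opprB. Qed.

Lemma nrm_triangle u v : nrm (u + v) <= nrm u + nrm v.
Proof.
rewrite -ler_sqr ?nnegrE ?addr_ge0 ?nrm_ge0 // sqrrD !nrm_sqr sqnormD.
by rewrite lerD2r lerD2l -[leRHS]mulr_natl ler_pM2l ?ltr0n // inner_le.
Qed.

Lemma nrm_realZ x u : nrm (of_real k x *: u) = `|x| * nrm u.
Proof. by rewrite /nrm sqnorm_realZ sqrtrM ?sqr_ge0 // sqrtr_sqr. Qed.

End RealInner.

(** * Orthonormal bases and orthogonal projections *)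

Section Orthonormal.
Variables (R : realType) (k : scalar_kind) (n : nat).
Local Notation F := (scalars R k).
Local Notation conj := (conj_scalar R k).
Local Notation dot := (@dot R k n).
Implicit Types (u v w : 'rV[F]_n) (V W : Gr R k n) (e f g : seq 'rV[F]_n).

Lemma orthonormalP e : reflect
  (forall i j, (i < size e)%N -> (j < size e)%N -> dot e`_i e`_j = (i == j)%:R)
  (orthonormal dot e).
Proof.
elim: e => [|x e IH] /=; first by apply: ReflectT.
have -> : orthonormal dot (x :: e) =
    [&& dot x x == 1, all (fun y => dot x y == 0) e & orthonormal dot e].
  rewrite /orthonormal /= /ortho_rec /= andbT -!andbA; congr (_ && _).
  by rewrite andbCA.
apply: (iffP and3P) => [[/eqP x1 /allP xe /IH h] [|i] [|j] /=|h].
- by rewrite x1.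
- by move=> _ je; apply/eqP/xe/mem_nth.
- by move=> ie _; apply/dot_eq0C/eqP/xe/mem_nth.
- by move=> ie je; rewrite h.
- split; first by apply/eqP; exact: (h 0%N 0%N).
    by apply/(all_nthP 0) => i ie; apply/eqP; exact: (h 0%N i.+1).
  by apply/IH => i j ie je; exact: (h i.+1 j.+1).
Qed.

Lemma orthonormal_nth e i j :
  orthonormal dot e -> (i < size e)%N -> (j < size e)%N ->
  dot e`_i e`_j = (i == j)%:R.
Proof. by move/orthonormalP; apply. Qed.

Lemma dot_sum_orthonormal e (c : nat -> F) j :
  orthonormal dot e -> (j < size e)%N ->
  dot (\sum_(i < size e) c i *: e`_i) e`_j = c j.
Proof.
move=> oe je; rewrite dot_suml (bigD1 (Ordinal je)) //= big1.
  by rewrite addr0 dotZl orthonormal_nth // eqxx mulr1.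
move=> i /negbTE ij; rewrite dotZl orthonormal_nth //.
by move: ij; rewrite -val_eqE /= => ->; rewrite mulr0.
Qed.

Lemma orthonormal_free e : orthonormal dot e -> free e.
Proof.
move=> oe; apply/(@freeP _ _ _ (in_tuple e)) => c c0 i.
pose c' j := if insub j is Some i then c i else 0.
have c'E (j : 'I_(size e)) : c' j = c j by rewrite /c' valK.
rewrite -c'E -(dot_sum_orthonormal c' oe (ltn_ord i)).
under eq_bigr do rewrite c'E.
by rewrite c0 dot0l.
Qed.

Lemma orthonormal_span_expand e v : orthonormal dot e -> v \in <<e>>%VS ->
  v = \sum_(i < size e) dot v e`_i *: e`_i.
Proof.
move=> oe ve; rewrite {1}(@coord_span _ _ _ (in_tuple e) _ ve).
apply: eq_bigr => i _; congr (_ *: _).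
pose c' j := if insub j is Some i then coord (in_tuple e) i v else 0.
have c'E (j : 'I_(size e)) : c' j = coord (in_tuple e) j v by rewrite /c' valK.
rewrite -c'E -(dot_sum_orthonormal c' oe (ltn_ord i)); congr (dot _ _).
rewrite [RHS](@coord_span _ _ _ (in_tuple e) _ ve).
by apply: eq_bigr => j _; rewrite c'E.
Qed.

Lemma sqnorm_sum_orthogonal p (x : nat -> 'rV[F]_n) :
  (forall i j, (i < j)%N -> (j < p)%N -> dot (x i) (x j) = 0) ->
  sqnorm (\sum_(i < p) x i) = \sum_(i < p) sqnorm (x i).
Proof.
elim: p => [|p IH] h; first by rewrite !big_ord0; apply/eqP; rewrite sqnorm_eq0.
rewrite !big_ord_recr /= sqnorm_orthoD ?IH //.
- by move=> i j ij jp; apply: h => //; exact: ltnW.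
- by rewrite dot_suml big1 // => i _; exact: h.
Qed.

Lemma orthonormal_rcons e v : orthonormal dot e -> dot v v = 1 ->
  {in e, forall x, dot v x = 0} -> orthonormal dot (rcons e v).
Proof.
move=> /orthonormalP oe v1 ve; apply/orthonormalP => i j.
rewrite size_rcons !ltnS !nth_rcons => ie je.
case: ltngtP ie => // ie _; case: ltngtP je => // je _.
- by rewrite oe.
- by rewrite je (ltn_eqF ie); apply/dot_eq0C/ve/mem_nth.
- by rewrite ie (gtn_eqF je); apply/ve/mem_nth.
- by rewrite ie je eqxx.
Qed.

Lemma orthonormal_basis_of_size V e : orthonormal dot e -> {subset e <= V} ->
  (\dim V <= size e)%N -> orthonormal_basis V e.
Proof.
move=> oe eV dV; rewrite /orthonormal_basis oe andbT basisEfree dV andbT.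
by rewrite orthonormal_free //=; apply/span_subvP.
Qed.

(** The common induction behind Gram-Schmidt (Q is trivial) and the spectral
    theorem (Q says that w is an eigenvector): both add unit vectors one at a
    time, orthogonally to those already found. *)
Lemma extend_orthonormal V (Q : 'rV[F]_n -> Prop) f :
  (forall e, orthonormal dot e -> (forall x, x \in e -> x \in V /\ Q x) ->
     (size e < \dim V)%N ->
     exists w,
       [/\ w \in V, dot w w = 1, {in e, forall x, dot w x = 0} & Q w]) ->
  orthonormal dot f -> (forall x, x \in f -> x \in V /\ Q x) ->
  exists g, orthonormal_basis V (f ++ g) /\ forall x, x \in f ++ g -> Q x.
Proof.
move=> step; move Em : (\dim V - size f)%N => m; elim: m => [|m IH] in f Em *.
  move=> of_ fV; exists [::]; rewrite cats0; split; last by move=> x /fV[].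
  by apply: orthonormal_basis_of_size => [//|x /fV[]//|]; rewrite -subn_eq0 Em.
move=> of_ fV; have lt : (size f < \dim V)%N by rewrite -subn_gt0 Em.
have [w [wV w1 wf Qw]] := step f of_ fV lt.
have [||x|g] := IH (rcons f w).
- by rewrite size_rcons subnS Em.
- exact: orthonormal_rcons.
- by rewrite mem_rcons inE => /predU1P[->//|/fV].
- by rewrite cat_rcons; exists (w :: g).
Qed.

Lemma dot_normalized v :
  v != 0 -> let w := of_real k (nrm v)^-1 *: v in dot w w = 1.
Proof.
move=> v0 /=.
rewrite dot_sqnorm sqnorm_realZ -nrm_sqr -exprMn mulVf ?nrm_eq0 //.
by rewrite expr1n rmorph1.
Qed.

Lemma extend_orthonormal_basis V f : orthonormal dot f -> {subset f <= V} ->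
  exists g, orthonormal_basis V (f ++ g).
Proof.
move=> of_ fV.
have [e oe eV lt||x /fV|g [? _]] := @extend_orthonormal V (fun=> True) f.
- have [v vV ve] : exists2 v, v \in V & v \notin <<e>>%VS.
    apply/subvPn; apply/negP => /dimvS h.
    by have := leq_trans h (dim_span e); rewrite leqNgt lt.
  pose w := v - \sum_(i < size e) dot v e`_i *: e`_i.
  have w0 : w != 0.
    apply: contraNneq ve => /eqP; rewrite subr_eq0 => /eqP ->.
    by apply: memv_suml => i _; apply/memvZ/memv_span/mem_nth.
  exists (of_real k (nrm w)^-1 *: w); split => //.
  - apply: memvZ; apply: memvB => //; apply: memv_suml => i _; apply: memvZ.
    by have [] := eV e`_i (mem_nth _ (ltn_ord i)).
  - exact: dot_normalized.
  - move=> x /(nthP 0)[i ie <-]; rewrite dotZl dotBl.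
    by rewrite (dot_sum_orthonormal (fun i => dot v e`_i)) // subrr mulr0.
- by [].
- by [].
- by exists g.
Qed.

Lemma exists_orthonormal_basis V : exists e, orthonormal_basis V e.
Proof. by have [//|e oe] := @extend_orthonormal_basis V [::] isT; exists e. Qed.

Lemma orthonormal_basis_size V e : orthonormal_basis V e -> size e = \dim V.
Proof. by case/andP => /(size_basis (X := in_tuple e)) ->. Qed.

Lemma orthonormal_basis_mem V e i :
  orthonormal_basis V e -> (i < \dim V)%N -> e`_i \in V.
Proof.
move=> oe iV; have := oe; rewrite -(orthonormal_basis_size oe) in iV.
by case/andP => be _; exact: basis_mem be (mem_nth _ iV).
Qed.

Lemma orthonormal_basis_nth V e i j : orthonormal_basis V e ->
  (i < \dim V)%N -> (j < \dim V)%N -> dot e`_i e`_j = (i == j)%:R.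
Proof.
move=> oe; rewrite -(orthonormal_basis_size oe).
by case/andP: oe => _; exact: orthonormal_nth.
Qed.

Lemma orthonormal_basis_expand V e v : orthonormal_basis V e -> v \in V ->
  v = \sum_(i < \dim V) dot v e`_i *: e`_i.
Proof.
move=> oe; rewrite -(orthonormal_basis_size oe); case/andP: oe => be oe vV.
by apply: orthonormal_span_expand => //; rewrite (span_basis be).
Qed.

Lemma capv_orthov W : (W :&: orthov dot W)%VS = 0%VS.
Proof.
apply/eqP; rewrite -subv0; apply/subvP => v /memv_capP[vW /mem_orthovP h].
rewrite memv0 -sqnorm_eq0 /sqnorm h // raddf0 //.
Qed.

Lemma addv_orthov W v : v \in (W + orthov dot W)%VS.
Proof.
have [e oe] := exists_orthonormal_basis W.
rewrite -(subrK (\sum_(i < \dim W) dot v e`_i *: e`_i) v) addrC.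
apply: memv_add.
  by apply: memv_suml => i _; apply: memvZ; exact: orthonormal_basis_mem.
have ee := oe; apply/mem_orthovP => w /(orthonormal_basis_expand oe) ->.
have sz := orthonormal_basis_size oe; case/andP: oe => _ oe.
have E j : (j < \dim W)%N ->
    dot (\sum_(i < \dim W) dot v e`_i *: e`_i) e`_j = dot v e`_j.
  by rewrite -sz => /(dot_sum_orthonormal (fun i => dot v e`_i) oe).
apply: etrans (dot_sumr _ _ _ _) _; apply: big1 => i _.
by rewrite dotZr dotBl E // subrr mulr0.
Qed.

Lemma orthoproj_mem W v : orthoproj W v \in W.
Proof. exact: memv_pi. Qed.

Lemma orthoproj_id W v : v \in W -> orthoproj W v = v.
Proof. exact/daddv_pi_id/capv_orthov. Qed.

Lemma orthoproj_perp W v w : w \in W -> dot (v - orthoproj W v) w = 0.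
Proof.
move=> wW; rewrite -{1}(daddv_pi_add (capv_orthov W) (addv_orthov W v)).
rewrite addrC addKr; have := memv_pi (orthov dot W) W v.
by move=> /mem_orthovP; apply.
Qed.

Lemma dot_orthoproj W v w : w \in W -> dot (orthoproj W v) w = dot v w.
Proof. by move=> /(orthoproj_perp v) /eqP; rewrite dotBl subr_eq0 => /eqP. Qed.

Lemma orthoproj_selfadj W u v : dot (orthoproj W u) v = dot u (orthoproj W v).
Proof.
rewrite [RHS]dotC [LHS]dotC; rewrite -(dot_orthoproj v (orthoproj_mem W u)).
rewrite -dotC; by rewrite dot_orthoproj ?orthoproj_mem // -dotC.
Qed.

Lemma sqnorm_orthoproj_split W v :
  sqnorm v = sqnorm (orthoproj W v) + sqnorm (v - orthoproj W v).
Proof.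
rewrite -sqnorm_orthoD ?[_ + (v - _)]addrC ?subrK //.
exact/dot_eq0C/orthoproj_perp/orthoproj_mem.
Qed.

Lemma nrm_orthoproj_le W v : nrm (orthoproj W v) <= nrm v.
Proof.
by rewrite ler_wsqrtr // (sqnorm_orthoproj_split W v) lerDl sqnorm_ge0.
Qed.

Lemma nrm_orthoproj_best W v w :
  w \in W -> nrm (v - orthoproj W v) <= nrm (v - w).
Proof.
move=> wW; rewrite ler_wsqrtr //.
have -> : v - w = (v - orthoproj W v) + (orthoproj W v - w).
  by rewrite addrA subrK.
rewrite [leRHS]sqnorm_orthoD ?lerDl ?sqnorm_ge0 //.
by apply: orthoproj_perp; rewrite memvB ?orthoproj_mem.
Qed.

End Orthonormal.

(** * The spectral theorem over the real and the complex numbers *)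

Section Spectral.
Variables (R : realType) (k : scalar_kind).
Local Notation F := (scalars R k).
Local Notation conj := (conj_scalar R k).

Lemma dot_mulmx_hermitian m (M : 'M[F]_m) (u v : 'rV[F]_m) :
  (forall i j, M i j = conj (M j i)) -> dot (u *m M) v = dot u (v *m M).
Proof.
move=> hM; rewrite !dotE.
under eq_bigr do rewrite mxE mulr_suml.
under [RHS]eq_bigr do rewrite mxE rmorph_sum mulr_sumr.
rewrite exchange_big /=; apply: eq_bigr => i _; apply: eq_bigr => j _.
by rewrite rmorphM /= -hM mulrA mulrAC.
Qed.

Lemma hermitian_eigenvalue_real m (M : 'M[F]_m) a :
  (forall i j, M i j = conj (M j i)) -> eigenvalue M a -> a = of_real k (re a).
Proof.
move=> hM /eigenvalueP[v vM v0]; apply: conj_eq_real.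
have := dot_mulmx_hermitian v v hM; rewrite vM dotZl dotZr => /mulIf E.
apply/esym/E.
by rewrite dot_sqnorm fmorph_eq0 sqnorm_eq0.
Qed.

End Spectral.

(** A real symmetric matrix is Hermitian over the complex numbers, where an
    eigenvalue exists; that eigenvalue is real, and being an eigenvalue does not
    depend on the field. *)
Lemma hermitian_has_eigenvalue (R : realType) (k : scalar_kind) m
    (M : 'M[scalars R k]_m) :
  (0 < m)%N -> (forall i j, M i j = conj_scalar R k (M j i)) ->
  exists a, eigenvalue M a.
Proof.
case: k M => /= M m0 hM; last exact: eigenvalue_closed.
have [a ea] := @eigenvalue_closed R[i] m (map_mx (real_complex R) M) m0.
have hC (i j : 'I_m) : map_mx (real_complex R) M i j =
    conj_scalar R ComplexScalars (map_mx (real_complex R) M j i).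
  by rewrite !mxE hM; apply/esym/(@conj_of_real R ComplexScalars).
have /= aE := @hermitian_eigenvalue_real R ComplexScalars _ _ a hC ea.
exists (complex.Re a); rewrite -(eigenvalue_map (real_complex R)).
by move: ea; rewrite {1}aE.
Qed.

Section SelfAdjoint.
Variables (R : realType) (k : scalar_kind) (n : nat).
Local Notation F := (scalars R k).
Local Notation conj := (conj_scalar R k).
Local Notation dot := (@dot R k n).
Implicit Types (u v w : 'rV[F]_n) (V W : Gr R k n) (e f g : seq 'rV[F]_n).

(** In an orthonormal basis e of V the operator A is given by a Hermitian
    matrix M; a row eigenvector of M lists the coordinates of v. *)
Lemma selfadjoint_eigenvector V (A : 'End('rV[F]_n)) : V != 0%VS ->
  (forall v, v \in V -> A v \in V) ->
  {in V &, forall u v, dot (A u) v = dot u (A v)} ->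
  exists v, [/\ v \in V, v != 0 & exists x, A v = of_real k x *: v].
Proof.
move=> V0 AV sA; have [e oe] := exists_orthonormal_basis V.
pose M : 'M[F]_(\dim V) := \matrix_(i, j) dot (A e`_i) e`_j.
have eV (i : 'I_(\dim V)) : e`_i \in V := orthonormal_basis_mem oe (ltn_ord i).
have hM i j : M i j = conj (M j i) by rewrite !mxE sA // -dotC.
have [|a ea] := hermitian_has_eigenvalue _ hM; first by rewrite lt0n dimv_eq0.
have aE := hermitian_eigenvalue_real hM ea.
have /eigenvalueP[c cM c0] := ea.
pose v := \sum_(i < \dim V) c 0 i *: e`_i.
have vV : v \in V by apply: memv_suml => i _; exact: memvZ.
have ve (j : 'I_(\dim V)) : dot v e`_j = c 0 j.
  rewrite dot_suml (bigD1 j) //= big1 => [|i /negbTE ij].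
    by rewrite dotZl (orthonormal_basis_nth oe) // eqxx mulr1 addr0.
  by rewrite dotZl (orthonormal_basis_nth oe) // val_eqE ij mulr0.
exists v; split => //.
  apply: contra_neq c0 => v0; apply/rowP => j.
  by rewrite -ve v0 dot0l mxE.
exists (re a); rewrite -aE (orthonormal_basis_expand oe (AV _ vV)).
rewrite [in RHS](orthonormal_basis_expand oe vV) scaler_sumr.
apply: eq_bigr => j _; rewrite scalerA ve; congr (_ *: _).
have := congr1 (fun r : 'rV_(\dim V) => r 0 j) cM; rewrite !mxE => <-.
rewrite {1}/v linear_sum dot_suml; apply: eq_bigr => i _.
by rewrite linearZ /= dotZl mxE.
Qed.

(** Once an orthonormal family e of eigenvectors is found, the part of V
    orthogonal to e is stable under A because A is self-adjoint, and it is
    nonzero because e extends to a longer orthonormal family. *)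
Lemma orthonormal_eigenbasis V (A : 'End('rV[F]_n)) :
  (forall v, v \in V -> A v \in V) ->
  {in V &, forall u v, dot (A u) v = dot u (A v)} ->
  exists2 e, orthonormal_basis V e &
    forall v, v \in e -> exists x, A v = of_real k x *: v.
Proof.
move=> AV sA; pose Q v := exists x, A v = of_real k x *: v.
have [e oe eVQ lt|||e [oe eQ]] := @extend_orthonormal R k n V Q [::];
  last first.
- by exists e.
- by [].
- by [].
pose U := (V :&: orthov dot <<e>>)%VS.
have eV : {subset e <= V} by move=> x /eVQ[].
have Ue v : v \in U -> {in e, forall x, dot v x = 0}.
  by move=> /memv_capP[_ /mem_orthovP h] x xe; apply: h; exact: memv_span.
have UI v : v \in V -> {in e, forall x, dot v x = 0} -> v \in U.
  move=> vV ve; apply/memv_capP; split => //; apply/mem_orthovP => w.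
  move=> /(orthonormal_span_expand oe) ->.
  apply: etrans (dot_sumr _ _ _ _) _; apply: big1 => i _.
  by rewrite dotZr ve ?mulr0 // mem_nth.
have [||u v uU vU|v [vU v0 [x Av]]] := @selfadjoint_eigenvector U A.
- have [[|w g] og] := extend_orthonormal_basis oe eV.
    by move: lt; rewrite -(orthonormal_basis_size og) cats0 ltnn.
  have wg : w \in e ++ w :: g by rewrite mem_cat mem_head orbT.
  case/andP: og => bg og; have wV := basis_mem bg wg.
  have w0 : w != 0 by exact: free_not0 (basis_free bg) wg.
  apply: contraNneq w0 => U0; rewrite -memv0 -U0.
  apply: UI => // y /(nthP 0)[i ie <-].
  have sz : (size e < size (e ++ w :: g))%N.
    by rewrite size_cat /= addnS ltnS leq_addr.
  have := @orthonormal_nth R k n _ (size e) i og sz (ltn_trans ie sz).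
  by rewrite !nth_cat ltnn subnn ie /= gtn_eqF.
- move=> v vU; have vV : v \in V by case/memv_capP: vU.
  apply: UI (AV _ vV) _ => y ye; have [yV [x Ay]] := eVQ y ye.
  by rewrite sA // Ay dotZr (Ue v vU) ?mulr0.
- by apply: sA; [case/memv_capP: uU|case/memv_capP: vU].
exists (of_real k (nrm v)^-1 *: v); split.
- by apply: memvZ; case/memv_capP: vU.
- exact: dot_normalized.
- by move=> y ye; rewrite dotZl (Ue v vU) // mulr0.
- by exists x; rewrite linearZ /= Av !scalerA mulrC.
Qed.

End SelfAdjoint.

(** * Singular values of the projection between two subspaces *)

Section SVD.
Variables (R : realType) (k : scalar_kind) (n : nat).
Local Notation F := (scalars R k).
Local Notation conj := (conj_scalar R k).
Local Notation dot := (@dot R k n).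
Implicit Types (u v w : 'rV[F]_n) (V W : Gr R k n) (e f g : seq 'rV[F]_n).

(** An eigenbasis of the compression P_V P_W of the projection onto W: on V one
    has <P_V P_W u, v> = <P_W u, P_W v>, so the images of orthogonal
    eigenvectors are orthogonal. *)
Lemma projection_eigenbasis V W : exists2 e, orthonormal_basis V e &
  forall i j, (i < \dim V)%N -> (j < \dim V)%N -> i != j ->
    dot (orthoproj W e`_i) (orthoproj W e`_j) = 0.
Proof.
pose A := (orthoproj V \o orthoproj W)%VF.
have AE u v : v \in V -> dot (A u) v = dot (orthoproj W u) (orthoproj W v).
  move=> vV; rewrite comp_lfunE dot_orthoproj //.
  by rewrite -orthoproj_selfadj (orthoproj_id (orthoproj_mem W u)).
have [v _||e oe eA] := @orthonormal_eigenbasis R k n V A.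
- by rewrite comp_lfunE orthoproj_mem.
- by move=> u v uV vV; rewrite AE // [RHS]dotC AE // -dotC.
exists e => // i j iV jV ij.
have [x Ax] : exists x, A e`_i = of_real k x *: e`_i.
  by apply: eA; apply: mem_nth; rewrite (orthonormal_basis_size oe).
rewrite -AE ?(orthonormal_basis_mem oe) // Ax dotZl.
by rewrite (orthonormal_basis_nth oe) // (negbTE ij) mulr0.
Qed.

Lemma sorted_projection_eigenbasis V W : exists e, [/\ orthonormal_basis V e,
  forall i j, (i < \dim V)%N -> (j < \dim V)%N -> i != j ->
    dot (orthoproj W e`_i) (orthoproj W e`_j) = 0 &
  sorted >=%R [seq nrm (orthoproj W x) | x <- e]].
Proof.
have [e0 oe0 h0] := projection_eigenbasis V W.
have he x y : x \in e0 -> y \in e0 -> x != y ->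
    dot (orthoproj W x) (orthoproj W y) = 0.
  move=> /(nthP 0)[i ie <-] /(nthP 0)[j je <-] ij.
  apply: h0; rewrite -?(orthonormal_basis_size oe0) //.
  by apply: contraNneq ij => ->.
pose r : rel 'rV[F]_n := relpre (fun x => nrm (orthoproj W x)) >=%R.
have pe : perm_eq (sort r e0) e0 by rewrite perm_sort.
have /andP[be0 on0] := oe0; have ue : uniq (sort r e0).
  by rewrite (perm_uniq pe) free_uniq // (basis_free be0).
have sz : size (sort r e0) = \dim V.
  by rewrite (perm_size pe) (orthonormal_basis_size oe0).
have he0 x y : x \in e0 -> y \in e0 -> dot x y = (x == y)%:R.
  move=> /(nthP 0)[i ie <-] /(nthP 0)[j je <-].
  by rewrite (orthonormal_nth on0) // nth_uniq // free_uniq // (basis_free be0).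
exists (sort r e0); split.
- apply/andP; split; first by rewrite (perm_basis _ pe).
  apply/orthonormalP => i j ie je; rewrite he0 -?(perm_mem pe) ?mem_nth //.
  by rewrite nth_uniq.
- move=> i j; rewrite -sz => ie je ij.
  by apply: he; rewrite -?(perm_mem pe) ?mem_nth // nth_uniq.
- rewrite sorted_map; apply: sort_sorted => x y; rewrite /r /=; exact: ge_total.
Qed.

(** The singular values are the norms of the projections of an eigenbasis e in
    decreasing order; the normalized nonzero projections start the basis of W,
    and any orthonormal completion serves for the zero singular values. *)
Lemma exists_singular_values V W :
  exists s, is_singular_values V W (orthoproj W) s.
Proof.
have [e [oe eo es]] := sorted_projection_eigenbasis V W.
have sz := orthonormal_basis_size oe.
pose P := orthoproj W; pose N x := nrm (P x).
(* By the ordering, the vectors with nonzero projection are the first r. *)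
pose r := find (fun x => P x == 0) e.
have rV : (r <= \dim V)%N by rewrite -sz find_size.
have Pr i : (i < r)%N -> P e`_i != 0 by move/(before_find 0) => /= ->.
have P0 i : (r <= i < \dim V)%N -> P e`_i = 0.
  move=> /andP[ri iV]; have rV' := leq_ltn_trans ri iV.
  apply/eqP; rewrite -nrm_eq0 eq_le nrm_ge0 andbT.
  have /eqP <- : N e`_r == 0.
    rewrite nrm_eq0; apply: (nth_find 0 (a := fun x => P x == 0)).
    by rewrite has_find sz.
  have := @sorted_leq_nth _ (>=%R : rel R) _ _ 0 _ es r i.
  rewrite !inE !size_map sz !(nth_map 0) ?sz //; apply => //.
  - by move=> x y z h1 h2; exact: le_trans h2 h1.
  - by move=> x /=.
pose g0 := [seq of_real k (N x)^-1 *: P x | x <- take r e].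
have szg : size g0 = r by rewrite size_map size_takel ?sz.
have g0E i : (i < r)%N -> g0`_i = of_real k (N e`_i)^-1 *: P e`_i.
  by move=> ir; rewrite (nth_map 0) ?size_takel ?sz // nth_take.
have og0 : orthonormal dot g0.
  apply/orthonormalP => i j; rewrite szg => ir jr; rewrite !g0E //.
  have [->|ij] := eqVneq i j; first exact: dot_normalized (Pr _ jr).
  by rewrite dotZl dotZr eo ?mulr0 // ?(leq_trans _ rV).
have g0W : {subset g0 <= W}.
  by move=> _ /mapP[x _ ->]; apply/memvZ/orthoproj_mem.
have [g og] := extend_orthonormal_basis og0 g0W.
have rW : (r <= \dim W)%N.
  by rewrite -(orthonormal_basis_size og) size_cat szg leq_addr.
pose m := minn (\dim V) (\dim W).
have rm : (r <= m)%N by rewrite leq_min rV rW.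
have mV : (m <= \dim V)%N by rewrite geq_minl.
exists [seq N x | x <- take m e]; split.
- by rewrite size_map size_takel ?sz.
- by rewrite map_take take_sorted.
- by move=> _ /mapP[x _ ->]; exact: nrm_ge0.
exists e, (g0 ++ g); split => // i.
- move=> im; rewrite (nth_map 0) ?size_takel ?sz // nth_take // nth_cat szg.
  case: ltnP => ir; last first.
    have Pi : P e`_i = 0 by apply: P0; rewrite ir (leq_trans im).
    rewrite -/P Pi /N Pi.
    have /eqP -> : nrm (0 : 'rV[F]_n) == 0 by rewrite nrm_eq0.
    by rewrite rmorph0 scale0r.
  rewrite g0E // scalerA -rmorphM mulfV ?nrm_eq0 ?Pr //.
  by rewrite rmorph1 scale1r.
- by move=> /andP[mi iV]; apply: P0; rewrite (leq_trans rm).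
Qed.

Lemma singular_valuesP V W :
  is_singular_values V W (orthoproj W) (singular_values V W (orthoproj W)).
Proof.
have [s hs] := exists_singular_values V W.
exact: (@xgetPex _ [::] (is_singular_values V W (orthoproj W))
                  (ex_intro _ s hs)).
Qed.

Lemma nrm_orthonormal_basis V e i :
  orthonormal_basis V e -> (i < \dim V)%N -> nrm e`_i = 1.
Proof.
move=> oe iV; rewrite /nrm /sqnorm (orthonormal_basis_nth oe) // eqxx.
by rewrite -[1%:R](rmorph1 (of_real k)) of_realK sqrtr1.
Qed.

Lemma singular_values_le1 V W s i : is_singular_values V W (orthoproj W) s ->
  (i < minn (\dim V) (\dim W))%N -> 0 <= s`_i <= 1.
Proof.
move=> [ss _ s0 [e [f [oe of_ ef _]]]] im; have s0i : 0 <= s`_i.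
  by apply: s0; rewrite mem_nth ?ss.
rewrite s0i /=; move: (im); rewrite leq_min => /andP[iV iW].
have := nrm_orthoproj_le W e`_i; rewrite ef // nrm_realZ ger0_norm //.
by rewrite (nrm_orthonormal_basis oe) // (nrm_orthonormal_basis of_) // mulr1.
Qed.

(** The projections V -> W and W -> V are adjoint, so one decomposition read
    backwards is a decomposition of the other. *)
Lemma singular_values_sym V W s : \dim V = \dim W ->
  is_singular_values V W (orthoproj W) s ->
  is_singular_values W V (orthoproj V) s.
Proof.
move=> VW [ss sd s0 [e [f [oe of_ ef e0]]]].
have mV : minn (\dim V) (\dim W) = \dim V by rewrite VW minnn.
rewrite mV in ss ef e0.
split; rewrite /= ?[minn (\dim W) _]minnC ?mV //.
exists f, e; split => // i; last first.
  by rewrite -VW => /andP[h1 h2]; have := leq_trans h2 h1; rewrite ltnn.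
move=> iV; have iW : (i < \dim W)%N by rewrite -VW.
rewrite (orthonormal_basis_expand oe (orthoproj_mem V _)).
rewrite (bigD1 (Ordinal iV)) //= big1 ?addr0 => [|j ji].
  rewrite dot_orthoproj ?(orthonormal_basis_mem oe) //.
  rewrite -{1}[f`_i](orthoproj_id (orthonormal_basis_mem of_ iW)).
  rewrite orthoproj_selfadj.
  by rewrite ef // dotZr conj_of_real (orthonormal_basis_nth of_) // eqxx mulr1.
have jV := ltn_ord j; have jW : (j < \dim W)%N by rewrite -VW.
rewrite dot_orthoproj ?(orthonormal_basis_mem oe) //.
rewrite -{1}[f`_i](orthoproj_id (orthonormal_basis_mem of_ iW)).
rewrite orthoproj_selfadj.
rewrite ef // dotZr (orthonormal_basis_nth of_) //.
have /negbTE -> : i != j by rewrite eq_sym -(inj_eq val_inj) in ji *.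
by rewrite mulr0 scale0r.
Qed.

Definition gap_le V W (eta : R) :=
  forall v, v \in V -> nrm (v - orthoproj W v) <= eta * nrm v.

(** By Pythagoras in the two bases of the decomposition,
    |v - P_W v|^2 = |v|^2 - |P_W v|^2 is the sum of the |c_i|^2 (1 - s_i^2),
    where the c_i are the coordinates of v. *)
Lemma gap_le_of_singular_values V W s eta : (\dim V <= \dim W)%N ->
  is_singular_values V W (orthoproj W) s -> 0 <= eta ->
  (forall i, (i < \dim V)%N -> 1 - s`_i ^+ 2 <= eta ^+ 2) -> gap_le V W eta.
Proof.
move=> VW [_ _ _ [e [f [oe of_ ef _]]]] eta0 hs v vV.
rewrite (minn_idPl VW) in ef.
rewrite -ler_sqr ?nnegrE ?mulr_ge0 ?nrm_ge0 // exprMn !nrm_sqr.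
have -> : sqnorm (v - orthoproj W v) = sqnorm v - sqnorm (orthoproj W v).
  by rewrite [sqnorm v](sqnorm_orthoproj_split W) addrAC subrr add0r.
pose c i := dot v e`_i.
have iW (i : nat) : (i < \dim V)%N -> (i < \dim W)%N.
  by move=> h; exact: leq_trans VW.
have sv : sqnorm v = \sum_(i < \dim V) sqabs (c i).
  rewrite {1}(orthonormal_basis_expand oe vV).
  rewrite (sqnorm_sum_orthogonal (x := fun i => c i *: e`_i)) => [|i j ij jV].
    apply: eq_bigr => i _; rewrite sqnormZ -nrm_sqr.
    by rewrite (nrm_orthonormal_basis oe) // expr1n mulr1.
  rewrite dotZl dotZr (orthonormal_basis_nth oe) //; last exact: ltn_trans jV.
  by rewrite (ltn_eqF ij) !mulr0.
have sP : sqnorm (orthoproj W v) = \sum_(i < \dim V) sqabs (c i) * s`_i ^+ 2.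
  rewrite {1}(orthonormal_basis_expand oe vV) linear_sum.
  rewrite (eq_bigr (fun i : 'I__ => c i *: (of_real k s`_i *: f`_i)));
    last first.
    by move=> i _; rewrite linearZ /= ef.
  rewrite (sqnorm_sum_orthogonal
            (x := fun i => c i *: (of_real k s`_i *: f`_i))).
    apply: eq_bigr => i _; rewrite sqnormZ sqnorm_realZ -nrm_sqr.
    by rewrite (nrm_orthonormal_basis of_) ?iW // expr1n mulr1.
  move=> i j ij jV; rewrite !dotZl !dotZr (orthonormal_basis_nth of_) ?iW //.
    by rewrite (ltn_eqF ij) !mulr0.
  exact: ltn_trans jV.
rewrite sv sP -sumrB mulr_sumr; apply: ler_sum => i _.
by rewrite -{1}[sqabs _]mulr1 -mulrBr mulrC ler_wpM2r ?sqabs_ge0 ?hs.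
Qed.

Lemma singular_values_of_gap_le V W s eta i :
  is_singular_values V W (orthoproj W) s ->
  gap_le V W eta -> (i < minn (\dim V) (\dim W))%N -> 1 - s`_i ^+ 2 <= eta ^+ 2.
Proof.
move=> hs hgap im; have /andP[s0 s1] := singular_values_le1 hs im.
move: hs im => [_ _ _ [e [f [oe of_ ef _]]]] im.
move: (im); rewrite leq_min => /andP[iV iW].
have := hgap _ (orthonormal_basis_mem oe iV).
rewrite (nrm_orthonormal_basis oe) // mulr1 => h.
have -> : 1 - s`_i ^+ 2 = nrm (e`_i - orthoproj W e`_i) ^+ 2.
  have := sqnorm_orthoproj_split W e`_i; rewrite -!nrm_sqr ef // nrm_realZ.
  rewrite (nrm_orthonormal_basis oe) // (nrm_orthonormal_basis of_) //.
  rewrite expr1n mulr1 ger0_norm // => E.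
  by rewrite {1}E addrAC subrr add0r.
by rewrite ler_sqr ?nnegrE ?nrm_ge0 // (le_trans _ h) ?nrm_ge0.
Qed.
End SVD.

(** * Comparison of the asymmetric metrics with the gap *)

Section Metrics.
Variables (R : realType) (k : scalar_kind) (n : nat).
Local Notation F := (scalars R k).
Implicit Types (V W : Gr R k n) (d : metric_name).

Lemma cos_principal_angle V W i : (i < minn (\dim V) (\dim W))%N ->
  cos (principal_angles V W)`_i = (singular_values V W (orthoproj W))`_i.
Proof.
move=> im; have hs := singular_valuesP V W.
have [ss _ _ _] := hs; have /andP[s0 s1] := singular_values_le1 hs im.
rewrite (nth_map 0) ?ss // acosK // in_itv /= s1 andbT.
by apply: le_trans s0; rewrite oppr_le0.
Qed.

Lemma principal_angle_quadrant V W i : (i < minn (\dim V) (\dim W))%N ->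
  0 <= (principal_angles V W)`_i <= pi / 2.
Proof.
move=> im; have hs := singular_valuesP V W.
have [ss _ _ _] := hs; have /andP[s0 s1] := singular_values_le1 hs im.
rewrite (nth_map 0) ?ss //.
have sN : -1 <= (singular_values V W (orthoproj W))`_i.
  by apply: le_trans s0; rewrite oppr_le0.
rewrite acos_ge0 ?sN //= acos_le ?cos_pihalf //.
by have := pi_ge0 R; lra.
Qed.

Lemma asym_distE d V W : \dim V != 0%N -> (\dim V <= \dim W)%N ->
  asym_dist d V W = angle_metric d (\dim V) (principal_angles V W).
Proof. by move=> /negbTE V0; rewrite /asym_dist V0 leqNgt => /negbTE ->. Qed.

Lemma asym_dist_ge_sin d V W : \dim V != 0%N -> (\dim V <= \dim W)%N ->
  sin (principal_angles V W)`_(\dim V).-1 <= asym_dist d V W.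
Proof.
move=> V0 VW; rewrite asym_distE // angle_metric_ge_sin ?lt0n // => i iV.
by apply: principal_angle_quadrant; rewrite (minn_idPl VW).
Qed.

Lemma asym_dist_ge0 d V W : 0 <= asym_dist d V W.
Proof.
have [V0|V0] := eqVneq (\dim V) 0%N; first by rewrite /asym_dist V0.
have [VW|WV] := leqP (\dim V) (\dim W).
  apply: le_trans (asym_dist_ge_sin d V0 VW); apply/sin_ge0_pihalf.
  by apply: principal_angle_quadrant; rewrite (minn_idPl VW) prednK ?lt0n.
rewrite /asym_dist (negbTE V0) WV; apply: le_trans (Delta_ge1 R d _) => //.
by rewrite lt0n.
Qed.

Lemma asym_dist_le_Delta d V W p : (\dim V <= p)%N -> (0 < p)%N ->
  asym_dist d V W <= Delta R d p.
Proof.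
move=> Vp p0; have [V0|V0] := eqVneq (\dim V) 0%N.
  by rewrite /asym_dist V0 (le_trans ler01) // Delta_ge1.
apply: le_trans (Delta_nondecreasing R d Vp).
have [VW|WV] := leqP (\dim V) (\dim W); last first.
  by rewrite /asym_dist (negbTE V0) WV.
rewrite asym_distE // angle_metric_le_Delta ?lt0n // => i iV.
by apply: principal_angle_quadrant; rewrite (minn_idPl VW).
Qed.

Lemma asym_dist_ge1 d V W : (\dim W < \dim V)%N -> 1 <= asym_dist d V W.
Proof.
move=> WV; have V0 : (0 < \dim V)%N by exact: leq_ltn_trans WV.
by rewrite /asym_dist gtn_eqF // WV Delta_ge1.
Qed.

(** A gap of at most sin phi bounds every principal angle by phi, hence every
    metric by (dim V) phi. *)
Lemma asym_dist_le_of_gap d V W eta phi :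
  \dim V != 0%N -> (\dim V <= \dim W)%N ->
  0 <= phi -> (\dim V)%:R * phi <= pi / 2 -> 0 <= eta -> eta <= sin phi ->
  gap_le V W eta -> asym_dist d V W <= (\dim V)%:R * phi.
Proof.
move=> V0 VW phi0 phip eta0 etaphi hgap; have pi0 := pi_ge0 R.
have p1 : 1 <= (\dim V)%:R :> R by rewrite ler1n lt0n.
have phi2 : phi <= pi / 2 by apply: le_trans phip; rewrite ler_peMl.
rewrite asym_distE // angle_metric_le ?lt0n // => i iV.
have im : (i < minn (\dim V) (\dim W))%N by rewrite (minn_idPl VW).
have hq := principal_angle_quadrant im; have /andP[t0 t1] := hq.
rewrite t0 /= leNgt; apply/negP => lt.
have := singular_values_of_gap_le (singular_valuesP V W) hgap im.
rewrite -cos_principal_angle // -sin2cos2 ler_sqr ?nnegrE ?sin_ge0_pihalf //.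
rewrite leNgt; apply/negP/negPn; apply: (le_lt_trans etaphi).
by rewrite ltr_sin // in_itv /=; apply/andP; split; lra.
Qed.

(** Since d(V, W) >= sin theta_p, all 1 - s_i^2 are at most eta^2.  This bounds
    both gaps, as W and V have the same singular values in either order. *)
Lemma gap_le_of_asym_dist d V W eta : \dim V != 0%N -> \dim V = \dim W ->
  0 <= eta -> asym_dist d V W <= eta -> gap_le V W eta /\ gap_le W V eta.
Proof.
move=> V0 VW eta0 hd; have hs := singular_valuesP V W.
have mE : minn (\dim V) (\dim W) = \dim V by rewrite VW minnn.
have pV : ((\dim V).-1 < \dim V)%N by rewrite prednK ?lt0n.
set s := singular_values V W (orthoproj W) in hs.
have bound i : (i < \dim V)%N -> 1 - s`_i ^+ 2 <= eta ^+ 2.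
  move=> iV; have im : (i < minn (\dim V) (\dim W))%N by rewrite mE.
  have pm : ((\dim V).-1 < minn (\dim V) (\dim W))%N by rewrite mE.
  have [ss sd _ _] := hs; rewrite mE in ss.
  have /andP[si0 _] := singular_values_le1 hs im.
  have /andP[sp0 _] := singular_values_le1 hs pm.
  have sle : s`_(\dim V).-1 <= s`_i.
    have := @sorted_leq_nth _ (>=%R : rel R) _ _ 0 _ sd i (\dim V).-1.
    rewrite !inE ss; apply => //.
    - by move=> x y z h1 h2; exact: le_trans h2 h1.
    - by move=> x /=.
    - by rewrite -ltnS prednK // lt0n.
  apply: (@le_trans _ _ (1 - s`_(\dim V).-1 ^+ 2)).
    by rewrite lerD2l lerN2 ler_sqr ?nnegrE.
  rewrite -cos_principal_angle // -sin2cos2 ler_sqr ?nnegrE //.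
    by apply: le_trans hd; apply: asym_dist_ge_sin; rewrite -?VW.
  by apply/sin_ge0_pihalf/principal_angle_quadrant.
split; first by apply: (gap_le_of_singular_values _ hs) => //; rewrite VW.
apply: (gap_le_of_singular_values _ (singular_values_sym VW hs)) => //.
  by rewrite VW.
by rewrite -VW.
Qed.

Lemma dim_Gr_le V : (\dim V <= n)%N.
Proof. by have := dimvS (subvf V); rewrite dimvf /dim /= mul1n. Qed.

Lemma dim_Gr_full : \dim (fullv : Gr R k n) = n.
Proof. by rewrite dimvf /dim /= mul1n. Qed.

Lemma asym_dist_sub d V W : (V <= W)%VS -> asym_dist d V W = 0.
Proof.
move=> VW; have dVW := dimvS VW.
have [V0|V0] := eqVneq (\dim V) 0%N; first by rewrite /asym_dist V0.
apply/eqP; rewrite eq_le asym_dist_ge0 andbT.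
rewrite -[leRHS](mulr0 (\dim V)%:R).
apply: (@asym_dist_le_of_gap d V W 0) => //; rewrite ?mulr0 ?sin0 //.
  by have := pi_ge0 R; lra.
move=> v vV; rewrite orthoproj_id ?(subvP VW) // subrr mul0r.
by rewrite le_eqVlt nrm_eq0 eqxx.
Qed.

(** The blunt point is F^n for tau^- and 0 for tau^+: a ball that contains it
    either is centred at it, and then all its distances are 0, or has radius
    larger than the constant Delta that bounds all the relevant distances. *)
Lemma exists_blunt_point d s : exists c : ball_space s (@asym_dist R k n d),
  forall U, nbhs c U -> U = setT.
Proof.
have key (c : ball_space s (@asym_dist R k n d)) :
    (forall x r, 0 < r -> asym_ball s (asym_dist d) x r c ->
       asym_ball s (asym_dist d) x r = setT) ->
    forall U, nbhs c U -> U = setT.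
  move=> h U; rewrite nbhsE => -[B [[D sD <-] [A DA Ac]] BU].
  suff AT : A = setT.
    apply/seteqP; split => // x _; apply: BU; exists A => //; by rewrite AT.
  have /= [I sI IA] := sD _ DA; rewrite -IA in Ac *.
  apply/seteqP; split => // x _ J JI; have /set_mem := sI _ JI.
  move=> [y [r [r0 E]]]; rewrite /= E in Ac *.
  have := h y r r0; rewrite -E => -> //. exact: Ac.
case: s key => key.
- exists fullv; apply: key => V r r0 /= h; apply/seteqP; split => // U _ /=.
  have [nV|Vn] := leqP n (\dim (V : Gr R k n)).
    have /eqP -> : (V : Gr R k n) == fullv by rewrite eqEdim subvf dim_Gr_full.
    by rewrite asym_dist_sub ?subvf.
  have n0 : (0 < n)%N by exact: leq_ltn_trans Vn.
  apply: le_lt_trans h; rewrite {2}/asym_dist dim_Gr_full gtn_eqF // Vn.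
  by apply: asym_dist_le_Delta => //; exact: dim_Gr_le.
- exists 0%VS; apply: key => V r r0 /= h; apply/seteqP; split => // U _ /=.
  have [V0|V0] := eqVneq (\dim V) 0%N; first by rewrite /asym_dist V0.
  apply: le_lt_trans h; rewrite {2}/asym_dist (negbTE V0) dimv0 lt0n V0.
  by apply: asym_dist_le_Delta; rewrite ?lt0n.
Qed.
End Metrics.

(** * Limits of gap-Cauchy sequences of subspaces *)

Section Completeness.
Variables (R : realType) (k : scalar_kind) (n : nat).
Local Notation F := (scalars R k).
Local Notation dot := (@dot R k n).
Implicit Types (u v w : 'rV[F]_n) (V W : Gr R k n).

Lemma real_cauchy_cvg (u : nat -> R) :
  (forall eps : R, 0 < eps -> exists N, forall i j,
     (N <= i)%N -> (N <= j)%N -> `|u i - u j| < eps) ->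
  exists a : R, u @ \oo --> a.
Proof.
move=> hu; suff : cvg (u @ \oo) by move=> cu; exists (lim (u @ \oo)).
apply/cauchy_cvgP; apply: cauchy_exP => eps /hu[N hN]; exists (u N).
exists N => // i /= Ni; rewrite -ball_normE /=; exact: hN.
Qed.

Lemma imB (z1 z2 : F) : im (z1 - z2) = im z1 - im z2.
Proof.
by move: z1 z2; rewrite /im; case: k => /= [|[a b] [c d]//]; rewrite subr0.
Qed.

Lemma sqabs_coord_le u j : sqabs (u 0 j) <= sqnorm u.
Proof.
rewrite sqnormE (bigD1 j) //= lerDl sumr_ge0 // => i _; exact: sqabs_ge0.
Qed.

Definition of_re_im (a b : R) : F :=
  match k return scalars R k with
  | RealScalars => a
  | ComplexScalars => (a +i* b)%C
  end.

(** Only an inequality, because over the reals [of_re_im] drops b. *)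
Lemma sqabs_of_re_im z a b :
  sqabs (z - of_re_im a b) <= (re z - a) ^+ 2 + (im z - b) ^+ 2.
Proof.
move: z; rewrite /sqabs /re /im /of_re_im; case: k => /= [z|[c d]] //=.
by rewrite lerD2l expr0n /= sqr_ge0.
Qed.

Lemma vector_cauchy_cvg (x : nat -> 'rV[F]_n) :
  (forall eps : R, 0 < eps -> exists N, forall i j, (N <= i)%N -> (N <= j)%N ->
     nrm (x i - x j) < eps) ->
  exists a, forall eps : R, 0 < eps -> \forall i \near \oo, nrm (x i - a) < eps.
Proof.
move=> hx.
have reim (z : F) :
    `|re z| <= Num.sqrt (sqabs z) /\ `|im z| <= Num.sqrt (sqabs z).
  by rewrite -!sqrtr_sqr !ler_wsqrtr // ?lerDl ?lerDr sqr_ge0.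
have coord i l j : `|re (x i 0 j) - re (x l 0 j)| <= nrm (x i - x l) /\
    `|im (x i 0 j) - im (x l 0 j)| <= nrm (x i - x l).
  have h : Num.sqrt (sqabs ((x i - x l) 0 j)) <= nrm (x i - x l).
    by rewrite ler_wsqrtr // sqabs_coord_le.
  have [h1 h2] := reim ((x i - x l) 0 j).
  rewrite !mxE in h1 h2 h; rewrite imB raddfB /= in h1 h2.
  by split; [apply: le_trans h1 _|apply: le_trans h2 _].
have cre j : exists a : R, (fun i => re (x i 0 j)) @ \oo --> a.
  apply: real_cauchy_cvg => eps /hx[N hN]; exists N => i l Ni Nl.
  by apply: le_lt_trans (hN i l Ni Nl); case: (coord i l j).
have cim j : exists b : R, (fun i => im (x i 0 j)) @ \oo --> b.
  apply: real_cauchy_cvg => eps /hx[N hN]; exists N => i l Ni Nl.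
  by apply: le_lt_trans (hN i l Ni Nl); case: (coord i l j).
have [a ha] := choice cre; have [b hb] := choice cim.
exists (\row_j of_re_im (a j) (b j)) => eps eps0.
(* The choice of delta makes 2 n delta^2 < eps^2, also when n = 0. *)
pose N : R := n.+1%:R; pose delta := eps / (2 * N).
have N1 : 1 <= N by rewrite ler1n.
have delta0 : 0 < delta by rewrite divr_gt0 // mulr_gt0 //; lra.
have near_re : \forall i \near \oo, forall j, `|a j - re (x i 0 j)| < delta.
  by apply: filter_forall => j; have /cvgrPdist_lt := ha j; apply.
have near_im : \forall i \near \oo, forall j, `|b j - im (x i 0 j)| < delta.
  by apply: filter_forall => j; have /cvgrPdist_lt := hb j; apply.
apply: filterS2 near_re near_im => i hre him.
rewrite -(@ltr_pXn2r _ 2) ?nnegrE ?nrm_ge0 ?(ltW eps0) // nrm_sqr sqnormE.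
apply: (@le_lt_trans _ _ (\sum_(j < n) 2 * delta ^+ 2)).
  apply: ler_sum => j _; rewrite !mxE.
  apply: le_trans (sqabs_of_re_im _ _ _) _.
  have sq y : `|y| < delta -> y ^+ 2 <= delta ^+ 2.
    move=> h; rewrite -[y ^+ 2]real_normK ?num_real //.
    by rewrite ler_sqr ?nnegrE // ltW.
  have := sq _ (hre j); have := sq _ (him j).
  by rewrite -![(_ - _ (x i 0 j)) ^+ 2]sqrrN !opprB; lra.
rewrite sumr_const card_ord -[ltLHS]mulr_natr.
have -> : eps = 2 * N * delta by rewrite /delta mulrC divfK //; nra.
move: delta delta0 {hre him} => delta delta0.
have nN : n%:R <= N by rewrite ler_nat.
have n0 : 0 <= n%:R :> R by [].
have d2 : 0 < delta ^+ 2 by rewrite exprn_gt0.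
rewrite exprMn mulrAC ltr_pM2r //; nra.
Qed.

Lemma nrmZ a u : nrm (a *: u) = Num.sqrt (sqabs a) * nrm u.
Proof. by rewrite /nrm sqnormZ sqrtrM ?sqabs_ge0. Qed.

(** P_V - P_W = (1 - P_W) P_V - P_W (1 - P_V).  The first term is bounded by
    the gap from V to W; the second is the adjoint of (1 - P_V) P_W, which is
    bounded by the gap from W to V. *)
Lemma orthoproj_diff_le V W eta v :
  0 <= eta -> gap_le V W eta -> gap_le W V eta ->
  nrm (orthoproj V v - orthoproj W v) <= 2 * eta * nrm v.
Proof.
move=> eta0 hVW hWV.
have -> : orthoproj V v - orthoproj W v =
    (orthoproj V v - orthoproj W (orthoproj V v))
    - orthoproj W (v - orthoproj V v).
  by rewrite linearB /= opprB addrA subrK.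
have h1 : nrm (orthoproj V v - orthoproj W (orthoproj V v)) <= eta * nrm v.
  apply: le_trans (hVW _ (orthoproj_mem V v)) _.
  by rewrite ler_wpM2l // nrm_orthoproj_le.
set w := v - orthoproj V v; set y := orthoproj W w.
have h2 : nrm y <= eta * nrm v.
  have [->|y0] := eqVneq y 0.
    have /eqP -> : nrm (0 : 'rV[F]_n) == 0 by rewrite nrm_eq0.
    by rewrite mulr_ge0 ?nrm_ge0.
  have yp : 0 < nrm y by rewrite lt_def nrm_eq0 y0 nrm_ge0.
  rewrite -(ler_pM2l yp) -expr2 nrm_sqr.
  have -> : sqnorm y = inner (y - orthoproj V y) v.
    have -> : sqnorm y = inner w y.
      by rewrite /sqnorm /inner {1}/y dot_orthoproj ?orthoproj_mem.
    by rewrite innerC /inner {1}/w dotBr -orthoproj_selfadj -dotBl.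
  apply: le_trans (inner_le _ _) _; rewrite -!/(nrm _) mulrA [nrm y * eta]mulrC.
  by rewrite ler_wpM2r ?nrm_ge0 // hWV ?orthoproj_mem.
rewrite -mulrA mulrDl mul1r; apply: le_trans (nrm_triangle _ _) _.
by rewrite nrmN lerD.
Qed.

(** The projection onto W is injective on V. *)
Lemma gap_le_dim V W eta : eta < 1 -> gap_le V W eta -> (\dim V <= \dim W)%N.
Proof.
move=> eta1 hVW; have <- : \dim (orthoproj W @: V) = \dim V.
  apply: limg_dim_eq; apply/eqP; rewrite -subv0; apply/subvP => v.
  move=> /memv_capP[vV]; rewrite memv_ker => /eqP v0.
  have := hVW v vV; rewrite v0 subr0 memv0 -nrm_eq0 => h.
  by rewrite eq_le nrm_ge0 andbT; have := nrm_ge0 v; nra.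
by apply/dimvS/subvP => _ /memv_imgP[v _ ->]; exact: orthoproj_mem.
Qed.

Lemma eq0_of_nrm_le u c :
  0 <= c -> (forall eps : R, 0 < eps -> nrm u <= eps * c) -> u = 0.
Proof.
move=> c0 h; apply/eqP; rewrite -nrm_eq0 eq_le nrm_ge0 andbT.
apply/ler_addgt0Pl => eps eps0; rewrite addr0.
have c1 : 0 < c + 1 by lra.
apply: le_trans (h (eps / (c + 1)) _) _; first exact: divr_gt0.
by rewrite mulrAC ler_pdivrMr // ler_pM2l // lerDl.
Qed.

(** The projections P_i onto the x_i form a Cauchy sequence, uniformly on the
    unit ball, so their pointwise limit L is linear, idempotent and uniformly
    close to P_i.  Its fixed space a is the limit: a vector v of a satisfies
    v - P_i v = (L - P_i) v, and a vector v of x_i is as close to a as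
    v - L v = (P_i - L) v tells.  Gaps below 1 in both directions then give
    dim a = p. *)
Lemma gap_cauchy_limit (x : nat -> Gr R k n) p :
  (forall i, \dim (x i) = p) ->
  (forall eta : R, 0 < eta -> exists N, forall i j, (N <= i)%N -> (N <= j)%N ->
     gap_le (x i) (x j) eta) ->
  exists2 a : Gr R k n, \dim a = p & forall eta : R, 0 < eta ->
    exists N, forall i, (N <= i)%N -> gap_le (x i) a eta /\ gap_le a (x i) eta.
Proof.
move=> dx hx; pose P i := orthoproj (x i).
have PP (eta : R) : 0 < eta -> exists N, forall i j, (N <= i)%N -> (N <= j)%N ->
    forall v, nrm (P i v - P j v) <= eta * nrm v.
  move=> eta0; have [|N hN] := hx (eta / 2); first by lra.
  exists N => i j Ni Nj v; have -> : eta = 2 * (eta / 2) by lra.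
  by apply: orthoproj_diff_le; [lra|exact: hN|exact: hN].
have lim v : exists w, forall eps : R, 0 < eps ->
    \forall i \near \oo, nrm (P i v - w) < eps.
  apply: vector_cauchy_cvg => eps eps0.
  have v1 : 0 < nrm v + 1 by have := nrm_ge0 v; lra.
  have [|N hN] := PP (eps / (nrm v + 1)); first exact: divr_gt0.
  exists N => i j Ni Nj; apply: le_lt_trans (hN i j Ni Nj v) _.
  by rewrite mulrAC ltr_pdivrMr // ltr_pM2l // ltrDl.
have [L hL] := choice lim.
have PL (eta : R) : 0 < eta -> exists N, forall i, (N <= i)%N ->
    forall v, nrm (P i v - L v) <= eta * nrm v.
  move=> /PP[N hN]; exists N => i Ni v.
  apply/ler_addgt0Pr => eps eps0.
  have [M _ hM] := hL v eps eps0.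
  have := hM (maxn M N) (leq_maxl _ _) => /= h1.
  have h2 := hN i (maxn M N) Ni (leq_maxr _ _) v.
  apply: (@le_trans _ _
    (nrm ((P i v - P (maxn M N) v) + (P (maxn M N) v - L v)))).
    by rewrite addrA subrK.
  by apply: le_trans (nrm_triangle _ _) _; rewrite lerD // ltW.
have Llin : linear L.
  move=> b u v; apply/eqP; rewrite -subr_eq0; apply/eqP.
  set c := nrm (b *: u + v) + Num.sqrt (sqabs b) * nrm u + nrm v.
  apply: (@eq0_of_nrm_le _ c).
    by rewrite !addr_ge0 ?mulr_ge0 ?nrm_ge0 ?sqrtr_ge0.
  move=> eps /PL[N hN].
  have -> : L (b *: u + v) - (b *: L u + L v) =
     (L (b *: u + v) - P N (b *: u + v)) + b *: (P N u - L u) + (P N v - L v).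
    rewrite [P N _]linearP scalerBr /= -[RHS]addrA.
    rewrite [b *: P N u - _ + _]addrACA -opprD.
    by rewrite [RHS]addrA subrK.
  apply: le_trans (nrm_triangle _ _) _; rewrite /c mulrDr.
  apply: lerD; last exact: (hN N (leqnn N) v).
  apply: le_trans (nrm_triangle _ _) _; rewrite mulrDr; apply: lerD.
    by rewrite nrmBC; exact: (hN N (leqnn N) (b *: u + v)).
  rewrite nrmZ mulrCA ler_wpM2l ?sqrtr_ge0 //; exact: (hN N (leqnn N) u).
have PiP i v : P i (P i v) = P i v by rewrite /P orthoproj_id ?orthoproj_mem.
have Lid v : L (L v) = L v.
  apply/eqP; rewrite -subr_eq0; apply/eqP.
  apply: (@eq0_of_nrm_le _ (nrm (L v) + nrm v + nrm v)).
    by rewrite !addr_ge0 ?nrm_ge0.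
  move=> eps /PL[N hN].
  have -> : L (L v) - L v =
      (L (L v) - P N (L v)) + (P N (L v - P N v)) + (P N v - L v).
    by rewrite linearB /= PiP addrA [_ - _ + _]addrA subrK subrK.
  apply: le_trans (nrm_triangle _ _) _; rewrite mulrDr.
  apply: lerD; last exact: (hN N (leqnn N) v).
  apply: le_trans (nrm_triangle _ _) _; rewrite mulrDr; apply: lerD.
    by rewrite nrmBC; exact: (hN N (leqnn N) (L v)).
  apply: le_trans (nrm_orthoproj_le _ _) _.
  by rewrite nrmBC; exact: (hN N (leqnn N) v).
pose Lh : {linear 'rV[F]_n -> 'rV[F]_n} :=
  HB.pack L (GRing.isLinear.Build _ _ _ _ L Llin).
pose a := fixedSpace (linfun Lh).
have aP v : reflect (L v = v) (v \in a).
  by apply: (iffP fixedSpaceP); rewrite lfunE.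
have gaps (eta : R) : 0 < eta ->
    exists N, forall i, (N <= i)%N -> gap_le (x i) a eta /\ gap_le a (x i) eta.
  move=> /PL[N hN]; exists N => i Ni; split=> v.
    move=> vx; have La : L v \in a by apply/aP.
    apply: le_trans (nrm_orthoproj_best _ La) _.
    by have := hN i Ni v; rewrite {1}/P (orthoproj_id vx).
  by move=> /aP Lv; have := hN i Ni v; rewrite Lv nrmBC.
exists a => //; have [|N hN] := gaps 2^-1; first by rewrite invr_gt0.
have [g1 g2] := hN N (leqnn N); have h1 := half_lt1 R.
by apply/eqP; rewrite -(dx N) eqn_leq (gap_le_dim h1 g1) (gap_le_dim h1 g2).
Qed.
End Completeness.

(** * Smyth completeness and the theorem *)

Lemma bounded_monotone_eventually_constant (u : nat -> nat) N B :
  (forall i, (u i <= B)%N) ->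
  (forall i j, (N <= i)%N -> (i <= j)%N -> (u i <= u j)%N) ->
  exists M p, forall i, (M <= i)%N -> u i = p.
Proof.
move=> uB mono.
pose P m := `[< exists2 i, (N <= i)%N & u i = m >].
have exP : exists m, P m by exists (u N); apply/asboolP; exists N.
have leB m : P m -> (m <= B)%N by move=> /asboolP[i _ <-].
have [p /asboolP[M NM <-] pmax] := ex_maxnP exP leB.
exists M, (u M) => i Mi; apply/eqP; rewrite eqn_leq.
apply/andP; split; last exact: mono.
by apply: pmax; apply/asboolP; exists i => //; exact: leq_trans Mi.
Qed.

Section Smyth.
Variables (R : realType) (k : scalar_kind) (n : nat) (d : metric_name).
Local Notation dist := (@asym_dist R k n d).

(** Covers left and right K-Cauchy sequences at once: in equal dimensions
    either of d(x_i, x_j) and d(x_j, x_i) controls both gaps. *)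
Lemma equidimensional_cauchy_limit (x : nat -> Gr R k n) M p :
  (forall i, (M <= i)%N -> \dim (x i) = p) ->
  (forall eps : R, 0 < eps -> exists N, forall i j, (N <= i)%N -> (i <= j)%N ->
     dist (x i) (x j) < eps \/ dist (x j) (x i) < eps) ->
  exists a, (fun i => sym_dist dist (x i) a) @ \oo --> (0 : R).
Proof.
move=> dx cx.
suff [a ha] : exists a, forall eps : R, 0 < eps ->
    exists N, forall i, (N <= i)%N ->
    dist (x i) a < eps /\ dist a (x i) < eps.
  exists a; apply/cvgrPdist_lt => eps /ha[N hN]; exists N => // i /= /hN[h1 h2].
  by rewrite sub0r normrN ger0_norm ?le_max ?asym_dist_ge0 // gt_max h1.
have [p0|p0] := eqVneq p 0%N.
  exists 0%VS => eps eps0; exists M => i /dx; rewrite p0 => /eqP xi0.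
  by rewrite /asym_dist dimv0 xi0 eqxx.
pose y i := x (M + i)%N.
have dy i : \dim (y i) = p by apply: dx; rewrite leq_addr.
have y0 i : \dim (y i) != 0%N by rewrite dy.
have dyy i j : \dim (y i) = \dim (y j) by rewrite !dy.
have hy (eta : R) : 0 < eta -> exists N, forall i j, (N <= i)%N -> (N <= j)%N ->
    gap_le (y i) (y j) eta.
  move=> eta0; have [N hN] := cx eta eta0; exists N.
  suff h i j : (N <= i)%N -> (i <= j)%N ->
      gap_le (y i) (y j) eta /\ gap_le (y j) (y i) eta.
    move=> i j Ni Nj; have [ij|/ltnW ji] := leqP i j.
      by have [] := h i j Ni ij.
    by have [] := h j i Nj ji.
  move=> Ni ij; have e0 := ltW eta0.
  have [||h|h] := hN (M + i)%N (M + j)%N.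
  - by rewrite (leq_trans Ni) // leq_addl.
  - by rewrite leq_add2l.
  - exact: gap_le_of_asym_dist (y0 i) (dyy i j) e0 (ltW h).
  - by have [] := gap_le_of_asym_dist (y0 j) (dyy j i) e0 (ltW h).
have [a da ha] := gap_cauchy_limit dy hy.
exists a => eps eps0; have pi2 : 0 < pi / 2 :> R by rewrite divr_gt0 ?pi_gt0.
have pR : 0 < p%:R :> R by rewrite ltr0n lt0n.
(* [asym_dist_le_of_gap] asks that p phi be at most pi / 2. *)
pose phi := Num.min (eps / 2) (pi / 2) / p%:R.
have pphi : p%:R * phi = Num.min (eps / 2) (pi / 2).
  by rewrite mulrC divfK // gt_eqF.
have phi0 : 0 < phi by rewrite divr_gt0 // lt_min pi2 divr_gt0.
have pphi2 : p%:R * phi <= pi / 2 by rewrite pphi ge_min lexx orbT.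
have pphie : p%:R * phi < eps.
  by rewrite pphi gt_min; apply/orP; left; lra.
have p1 : 1 <= p%:R :> R by rewrite ler1n lt0n.
have phi2 : phi <= pi / 2 by apply: le_trans pphi2; rewrite ler_peMl // ltW.
have s0 : 0 < sin phi by apply: sin_gt0_pi; rewrite phi0 /=; lra.
have [N hN] := ha _ s0; exists (M + N)%N => i iMN.
have NiM : (N <= i - M)%N by rewrite leq_subRL // (leq_trans _ iMN) // leq_addr.
have [g1 g2] := hN (i - M)%N NiM.
have yi : y (i - M)%N = x i.
  by rewrite /y subnKC // (leq_trans _ iMN) // leq_addr.
rewrite -yi; split; apply: le_lt_trans pphie.
  by rewrite -(dy (i - M)%N); apply: (asym_dist_le_of_gap _ _ _ _ _ _ _ g1);
    rewrite ?da ?dy // ltW.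
by rewrite -da; apply: (asym_dist_le_of_gap _ _ _ _ _ _ _ g2);
  rewrite ?da ?dy // ltW.
Qed.

Lemma asym_dist_lt1_dim (V W : Gr R k n) : dist V W < 1 -> (\dim V <= \dim W)%N.
Proof.
by move=> h; rewrite leqNgt; apply/negP => /(asym_dist_ge1 d); rewrite leNgt h.
Qed.

Lemma asym_dist_Smyth_bicomplete : Smyth_bicomplete dist.
Proof.
split=> x cx.
- have [N hN] := cx 1 ltr01.
  have [||M [p dx]] :=
    @bounded_monotone_eventually_constant (fun i => \dim (x i)) N n.
  + by move=> i; exact: dim_Gr_le.
  + by move=> i j Ni ij; apply: asym_dist_lt1_dim; exact: hN.
  apply: (equidimensional_cauchy_limit dx) => eps /cx[N' h].
  by exists N' => i j Ni ij; left; exact: h.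
- have [N hN] := cx 1 ltr01.
  have [||M [p dx]] :=
    @bounded_monotone_eventually_constant (fun i => n - \dim (x i))%N N n.
  + by move=> i; exact: leq_subr.
  + by move=> i j Ni ij; apply/leq_sub2l/asym_dist_lt1_dim; exact: hN.
  have dx' i : (M <= i)%N -> \dim (x i) = (n - p)%N.
    by move=> /dx <-; rewrite subKn // dim_Gr_le.
  apply: (equidimensional_cauchy_limit dx') => eps /cx[N' h].
  by exists N' => i j Ni ij; right; exact: h.
Qed.
End Smyth.

Theorem proposition4p2 (R : realType) (k : scalar_kind) (n : nat)
    (d : metric_name) :
  (forall s : side,
     let X := ball_space s (@asym_dist R k n d) : topologicalType in
     [/\ @compact X setT,
         contractible R X,
         path_connected R X &
         simply_connected R X]) /\
  Smyth_bicomplete (@asym_dist R k n d).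
Proof.
split=> [s X|]; last exact: asym_dist_Smyth_bicomplete.
have [c blunt] := @exists_blunt_point R k n d s.
split.
- exact: blunt_compact blunt.
- exact: blunt_contractible blunt.
- exact: blunt_path_connected blunt.
- exact: blunt_simply_connected blunt.
Qed.
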